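(* The system $\mathrm{RCA}_0^\omega+\mathrm{IND}$ proves $\mathrm{SUB}_0\to\mathrm{QF\text{-}AC}^{0,1}$. Here $\mathrm{SUB}_0$ is the statement: for $D$ a directed subset of Baire space and $x_d:D\to[0,1]$ an increasing net converging to $x\in[0,1]$, there is $\Phi:\mathbb{N}\to D$ such that the sequence $\lambda n.x_{\Phi(n)}$ is increasing and $\lim_{n\to\infty}x_{\Phi(n)}=_{\mathbb{R}}x$.
   Context: Base theory. Finite types: $0$ (natural numbers) is a type, and if $\sigma,\tau$ are types then so is $\sigma\to\tau$ (mappings from type $\sigma$ to type $\tau$ objects); $1:=0\to0$ and $n+1:=n\to0$; a superscript on a variable is its type. $L_\omega$ is the language with variables and quantifiers of all finite types, constants $0,1,<_0,+_0,\times_0,=_0$ on $\mathbb{N}$, the combinators $\Pi,\Sigma$ and a recursor constant $\mathbf{R}_0$. Equality at higher types is defined extensionally: $x=_\tau y$ iff $xz_1\dots z_k=_0yz_1\dots z_k$ for all arguments. $\mathrm{QF\text{-}AC}^{\sigma,\tau}$ is the schema $(\forall x^\sigma)(\exists y^\tau)A(x,y)\to(\exists Y^{\sigma\to\tau})(\forall x^\sigma)A(x,Y(x))$ for quantifier-free $A$ of $L_\omega$ (parameters of any type allowed); $\mathrm{QF\text{-}AC}^{0,1}$ is the case $\sigma=0,\tau=1$. $\mathrm{RCA}_0^\omega$ is the theory in $L_\omega$ with classical logic and the axioms: $\mathbb{N}$ is an ordered semi-ring; the defining axioms of $\Pi,\Sigma$ (giving $\lambda$-abstraction); $\mathbf{R}_0(f,m,0)=m$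 and $\mathbf{R}_0(f,m,n+1)=f(n,\mathbf{R}_0(f,m,n))$; extensionality $x=_\rho y\to\varphi(x)=_\tau\varphi(y)$ for all types $\rho,\tau$ and $\varphi^{\rho\to\tau}$; induction for quantifier-free formulas of $L_\omega$; $\mathrm{QF\text{-}AC}^{1,0}$. $\mathrm{IND}$ is the induction schema for all formulas of $L_\omega$. Reals. A real is a sequence of rationals $(q_n)$ with $|q_n-q_{n+i}|<2^{-n}$ for all $n,i$ (a type 1 object); $(q_n)=_{\mathbb{R}}(r_n)$ iff $|q_n-r_n|\le2^{-n+1}$ for all $n$. Sets. A subset $D$ of Baire space $\mathbb{N}^{\mathbb{N}}$ is given by a characteristic function $F_D^2\le1$ ($f\in D$ means $F_D(f)=1$); a binary relation $\preceq$ on $D$ is likewise given by a characteristic function of type $(1\times1)\to0$. Nets. $(D,\preceq)$ with $D\neq\emptyset$ is directed if $\preceq$ is transitive and reflexive on $D$ and for all $x,y\in D$ there is $z\in D$ with $x\preceq z$ and $y\preceq z$. A net in $X\subseteq\mathbb{R}$ is a map $x_d:D\to X$ with $(D,\preceq)$ directed; all index sets are subsets of Baire space given by characteristic functions $F_D^2\le1$, with $\preceq$ given by a characteristic function of type $(1\times1)\to0$. The net $x_d$ is increasing if $a\preceq b$ implies $x_a\le_{\mathbb{R}}x_b$ for all $a,b\in D$. It converges to $y$ if $(\forall\varepsilon>0)(\exists d_0\in D)(\forall e\succeq d_0)(|x_e-y|<\varepsilon)$. *)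

(* Defs.v *)
From Stdlib Require Import List.
Import ListNotations.

Set Implicit Arguments.
Unset Strict Implicit.
Unset Printing Implicit Defensive.

Inductive ty : Set :=
| tp0 : ty
| arr : ty -> ty -> ty.

Declare Scope ty_scope.
Delimit Scope ty_scope with ty.
Bind Scope ty_scope with ty.
Open Scope ty_scope.
Notation "s ~> t" := (arr s t) (at level 60, right associativity) : ty_scope.

Definition tp1 : ty := tp0 ~> tp0.
Definition tp2 : ty := tp1 ~> tp0.

Implicit Types V W : ty -> Set.

(** Syntax is intrinsically typed and scoped: [V s] is the set of the variables
    of type [s] that may occur free, and [ext V s] has one more variable, of
    type [s] (well-scoped de Bruijn syntax). *)

Inductive ext (V : ty -> Set) (s : ty) : ty -> Set :=
| here : ext V s s
| there : forall t, V t -> ext V s t.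

Arguments here {V s}.
Arguments there {V s t} _.

Inductive tm (V : ty -> Set) : ty -> Set :=
| Var : forall s, V s -> tm V s
| App : forall s t, tm V (s ~> t) -> tm V s -> tm V t
| Zero : tm V tp0
| One : tm V tp0
| Plus : tm V (tp0 ~> tp0 ~> tp0)
| Times : tm V (tp0 ~> tp0 ~> tp0)
| Pi : forall s t, tm V (s ~> t ~> s)
| Sigma : forall r s t, tm V ((r ~> s ~> t) ~> (r ~> s) ~> r ~> t)
| Rec : tm V ((tp0 ~> tp0 ~> tp0) ~> tp0 ~> tp0 ~> tp0).

Arguments Var {V s} _.
Arguments App {V s t} _ _.
Arguments Zero {V}.
Arguments One {V}.
Arguments Plus {V}.
Arguments Times {V}.
Arguments Pi {V s t}.
Arguments Sigma {V r s t}.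
Arguments Rec {V}.

Inductive fm (V : ty -> Set) : Set :=
| Bot : fm V
| Eq : tm V tp0 -> tm V tp0 -> fm V
| Lt : tm V tp0 -> tm V tp0 -> fm V
| Imp : fm V -> fm V -> fm V
| All : forall s, fm (ext V s) -> fm V.

Arguments Bot {V}.
Arguments All {V} s _.

(** The logic is classical, so the other connectives are abbreviations. *)

Definition Neg V (p : fm V) : fm V := Imp p Bot.
Definition And V (p q : fm V) : fm V := Neg (Imp p (Neg q)).
Definition Or V (p q : fm V) : fm V := Imp (Neg p) q.
Definition Ex V s (p : fm (ext V s)) : fm V := Neg (All s (Neg p)).
Arguments Ex {V} s _.

Fixpoint qf V (p : fm V) : Prop :=
  match p with
  | Imp p q => qf p /\ qf q
  | All _ _ => False
  | _ => True
  end.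

Fixpoint tren V W (r : forall s, V s -> W s) s (t : tm V s) : tm W s :=
  match t with
  | Var v => Var (r _ v)
  | App f a => App (tren r f) (tren r a)
  | Zero => Zero
  | One => One
  | Plus => Plus
  | Times => Times
  | Pi => Pi
  | Sigma => Sigma
  | Rec => Rec
  end.

Definition shift V r s (t : tm V s) : tm (ext V r) s :=
  tren (fun _ v => there v) t.

Fixpoint tsubst V W (f : forall s, V s -> tm W s) s (t : tm V s) : tm W s :=
  match t with
  | Var v => f _ v
  | App g a => App (tsubst f g) (tsubst f a)
  | Zero => Zero
  | One => One
  | Plus => Plus
  | Times => Times
  | Pi => Pi
  | Sigma => Sigma
  | Rec => Rec
  end.

Definition scons V W r (t : tm W r) (f : forall s, V s -> tm W s) s
    (v : ext V r s) : tm W s :=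
  match v in ext _ _ s return tm W r -> tm W s with
  | here => fun t => t
  | there v => fun _ => f _ v
  end t.

Definition up V W (f : forall s, V s -> tm W s) r :
    forall s, ext V r s -> tm (ext W r) s :=
  scons (Var here) (fun s v => shift r (f s v)).

Fixpoint subst V W (f : forall s, V s -> tm W s) (p : fm V) : fm W :=
  match p with
  | Bot => Bot
  | Eq a b => Eq (tsubst f a) (tsubst f b)
  | Lt a b => Lt (tsubst f a) (tsubst f b)
  | Imp p q => Imp (subst f p) (subst f q)
  | All s p => All s (subst (up f (r := s)) p)
  end.

Definition inst V s (t : tm V s) (p : fm (ext V s)) : fm V :=
  subst (scons t (fun _ v => Var v)) p.

Definition fshift V s (p : fm V) : fm (ext V s) :=
  subst (fun _ v => Var (there v)) p.

(** [lam] is bracket abstraction.  The other three binders give a name to the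
    bound variable; terms from outside the binder must be shifted. *)

Fixpoint lam V s t (b : tm (ext V s) t) : tm V (s ~> t) :=
  match b in tm _ t return tm V (s ~> t) with
  | Var v =>
      match v in ext _ _ t return tm V (s ~> t) with
      | here => App (App Sigma (Pi (t := s ~> s))) Pi
      | there w => App Pi (Var w)
      end
  | App f a => App (App Sigma (lam f)) (lam a)
  | Zero => App Pi Zero
  | One => App Pi One
  | Plus => App Pi Plus
  | Times => App Pi Times
  | Pi => App Pi Pi
  | Sigma => App Pi Sigma
  | Rec => App Pi Rec
  end.

Definition fn V s t (b : tm (ext V s) s -> tm (ext V s) t) : tm V (s ~> t) :=
  lam (b (Var here)).
Definition fall V s (b : tm (ext V s) s -> fm (ext V s)) : fm V :=
  All s (b (Var here)).
Definition fex V s (b : tm (ext V s) s -> fm (ext V s)) : fm V :=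
  Ex s (b (Var here)).
Arguments fn {V} s {t} _.
Arguments fall {V} s _.
Arguments fex {V} s _.

Declare Scope tm_scope.
Delimit Scope tm_scope with tm.
Bind Scope tm_scope with tm.
Declare Scope fm_scope.
Delimit Scope fm_scope with fm.
Bind Scope fm_scope with fm.

Notation "↑ t" := (shift _ t) (at level 9, t at level 9, format "↑ t") : tm_scope.
Notation "f · a" := (App f a) (at level 25, left associativity) : tm_scope.
Notation "a + b" := (App (App Plus a%tm) b%tm) : tm_scope.
Notation "a * b" := (App (App Times a%tm) b%tm) : tm_scope.
Notation "0" := Zero : tm_scope.
Notation "1" := One : tm_scope.

Notation "a = b" := (Eq a%tm b%tm) : fm_scope.
Notation "a < b" := (Lt a%tm b%tm) : fm_scope.
Notation "a <= b" := (Or (Lt a%tm b%tm) (Eq a%tm b%tm)) : fm_scope.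
Notation "~ p" := (Neg p) : fm_scope.
Notation "p /\ q" := (And p q) : fm_scope.
Notation "p \/ q" := (Or p q) : fm_scope.
Notation "p ==> q" := (Imp p q) (at level 90, right associativity) : fm_scope.

Fixpoint eqt V (s : ty) : tm V s -> tm V s -> fm V :=
  match s return tm V s -> tm V s -> fm V with
  | tp0 => fun x y => Eq x y
  | r ~> t => fun x y => All r (eqt (App (shift r x) (Var here))
                                     (App (shift r y) (Var here)))
  end.

(** Natural deduction for classical many-sorted first-order logic; the axioms
    [T] may have free variables and thus stand for their universal closures. *)

Inductive prv (T : forall V, fm V -> Prop) :
    forall V, list (fm V) -> fm V -> Prop :=
| prv_ax : forall V (H : list (fm V)) p, T V p -> prv T H p
| prv_hyp : forall V (H : list (fm V)) p, In p H -> prv T H p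
| prv_impI : forall V (H : list (fm V)) p q,
    prv T (p :: H) q -> prv T H (Imp p q)
| prv_impE : forall V (H : list (fm V)) p q,
    prv T H (Imp p q) -> prv T H p -> prv T H q
| prv_raa : forall V (H : list (fm V)) p,
    prv T (Neg p :: H) Bot -> prv T H p
| prv_allI : forall V (H : list (fm V)) s (p : fm (ext V s)),
    prv T (map (fshift s) H) p -> prv T H (All s p)
| prv_allE : forall V (H : list (fm V)) s (p : fm (ext V s)) (t : tm V s),
    prv T H (All s p) -> prv T H (inst t p).

(** For [A] with distinguished variables [x] of type [s] and [y] of type [t]
    (the most recent one), [QFAC A] is
    (forall x, exists y, A(x, y)) -> exists Y, forall x, A(x, Y(x)). *)

Definition QFAC V s t (A : fm (ext (ext V s) t)) : fm V :=
  (All s (Ex t A) ==>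
   Ex (s ~> t) (All s
     (subst (scons (Var (there here) · Var here)%tm
              (scons (Var here) (fun _ v => Var (there (there v))))) A)))%fm.

Definition induction V (A : fm (ext V tp0)) : fm V :=
  (inst 0%tm A
   ==> All tp0 (A ==> subst (scons (Var here + 1)%tm
                              (fun _ v => Var (there v))) A)
   ==> All tp0 A)%fm.

Inductive RCA0w : forall V, fm V -> Prop :=
| ax_eq_refl : forall V (a : tm V tp0), RCA0w (a = a)%fm
| ax_eq_subst : forall V (a b : tm V tp0) (A : fm (ext V tp0)),
    RCA0w (a = b ==> inst a A ==> inst b A)%fm
| ax_addA : forall V (a b c : tm V tp0), RCA0w (a + (b + c) = (a + b) + c)%fm
| ax_addC : forall V (a b : tm V tp0), RCA0w (a + b = b + a)%fm
| ax_add0 : forall V (a : tm V tp0), RCA0w (a + 0 = a)%fm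
| ax_mulA : forall V (a b c : tm V tp0), RCA0w (a * (b * c) = (a * b) * c)%fm
| ax_mulC : forall V (a b : tm V tp0), RCA0w (a * b = b * a)%fm
| ax_mul0 : forall V (a : tm V tp0), RCA0w (a * 0 = 0)%fm
| ax_mul1 : forall V (a : tm V tp0), RCA0w (a * 1 = a)%fm
| ax_mulDr : forall V (a b c : tm V tp0),
    RCA0w (a * (b + c) = a * b + a * c)%fm
| ax_lt_irrefl : forall V (a : tm V tp0), RCA0w (~ (a < a))%fm
| ax_lt_trans : forall V (a b c : tm V tp0),
    RCA0w (a < b ==> b < c ==> a < c)%fm
| ax_lt_total : forall V (a b : tm V tp0),
    RCA0w (a < b \/ (a = b \/ b < a))%fm
| ax_lt_add : forall V (a b c : tm V tp0), RCA0w (a < b ==> a + c < b + c)%fm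
| ax_lt_mul : forall V (a b c : tm V tp0),
    RCA0w (0 < c ==> a < b ==> a * c < b * c)%fm
| ax_ge0 : forall V (a : tm V tp0), RCA0w (0 <= a)%fm
| ax_lt01 : forall V, RCA0w (0 < 1 : fm V)%fm
| ax_discrete : forall V (a b : tm V tp0), RCA0w (a < b ==> a + 1 <= b)%fm
| ax_Pi : forall V s t (x : tm V s) (y : tm V t), RCA0w (eqt (Pi · x · y)%tm x)
| ax_Sigma : forall V r s t
      (x : tm V (r ~> s ~> t)) (y : tm V (r ~> s)) (z : tm V r),
    RCA0w (eqt (Sigma · x · y · z)%tm (x · z · (y · z))%tm)
| ax_Rec0 : forall V (f : tm V (tp0 ~> tp0 ~> tp0)) (m : tm V tp0),
    RCA0w (Rec · f · m · 0 = m)%fm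
| ax_RecS : forall V (f : tm V (tp0 ~> tp0 ~> tp0)) (m n : tm V tp0),
    RCA0w (Rec · f · m · (n + 1) = f · n · (Rec · f · m · n))%fm
| ax_ext : forall V r t (x y : tm V r) (f : tm V (r ~> t)),
    RCA0w (eqt x y ==> eqt (f · x)%tm (f · y)%tm)%fm
| ax_qf_ind : forall V (A : fm (ext V tp0)), qf A -> RCA0w (induction A)
| ax_QFAC10 : forall V (A : fm (ext (ext V tp1) tp0)),
    qf A -> RCA0w (QFAC A).

Inductive IND : forall V, fm V -> Prop :=
| ax_ind : forall V (A : fm (ext V tp0)), IND (induction A).

Definition RCA0w_IND V (p : fm V) : Prop := RCA0w p \/ IND p.

Local Open Scope tm_scope.

Definition tpred V (n : tm V tp0) : tm V tp0 :=
  Rec · fn tp0 (fun k => fn tp0 (fun r => ↑k)) · 0 · n.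
Definition monus V (m n : tm V tp0) : tm V tp0 :=
  Rec · fn tp0 (fun k => fn tp0 (fun r => tpred r)) · m · n.
Definition pow2 V (n : tm V tp0) : tm V tp0 :=
  Rec · fn tp0 (fun k => fn tp0 (fun r => r + r)) · 1 · n.

(** The integer part of the square root: from [k] to [k + 1] the value [r] is
    incremented iff [(r + 1)^2 <= k + 1]. *)
Definition tsqrt V (n : tm V tp0) : tm V tp0 :=
  Rec · fn tp0 (fun k => fn tp0 (fun r =>
    r + monus 1 (monus ((r + 1) * (r + 1)) (↑k + 1)))) · 0 · n.

(** Pairs are coded by [(i, j) |-> (i + j)^2 + i]. *)
Definition tpair V (i j : tm V tp0) : tm V tp0 := (i + j) * (i + j) + i.
Definition tfst V (z : tm V tp0) : tm V tp0 := monus z (tsqrt z * tsqrt z).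
Definition tsnd V (z : tm V tp0) : tm V tp0 := monus (tsqrt z) (tfst z).

(** [Frac a b d] stands for the rational number (a - b) / d, with d > 0. *)
Record frac (V : ty -> Set) := Frac
  { fpos : tm V tp0; fneg : tm V tp0; fden : tm V tp0 }.

Definition fopp V (x : frac V) : frac V := Frac (fneg x) (fpos x) (fden x).
Definition fadd V (x y : frac V) : frac V :=
  Frac (fpos x * fden y + fpos y * fden x)
       (fneg x * fden y + fneg y * fden x)
       (fden x * fden y).
Definition fsub V (x y : frac V) : frac V := fadd x (fopp y).
Definition flt V (x y : frac V) : fm V :=
  (fpos x * fden y + fneg y * fden x < fpos y * fden x + fneg x * fden y)%fm.
Definition fle V (x y : frac V) : fm V :=
  (fpos x * fden y + fneg y * fden x <= fpos y * fden x + fneg x * fden y)%fm.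
(** |x| < y *)
Definition fabs_lt V (x y : frac V) : fm V := (flt x y /\ flt (fopp x) y)%fm.

(** 2^(-n) and 2^(-n+1) *)
Definition fpow2 V (n : tm V tp0) : frac V := Frac 1 0 (pow2 n).
Definition fpow2' V (n : tm V tp0) : frac V := Frac (1 + 1) 0 (pow2 n).

(** Every natural number codes a rational number: the code of (a - b) / (c + 1)
    is [rat_code a b c], and [rat] decodes. *)
Definition rat_code V (a b c : tm V tp0) : tm V tp0 := tpair a (tpair b c).
Definition rat V (q : tm V tp0) : frac V :=
  Frac (tfst q) (tfst (tsnd q)) (tsnd (tsnd q) + 1).

Local Open Scope fm_scope.

Definition is_real V (x : tm V tp1) : fm V :=
  fall tp0 (fun n => fall tp0 (fun i =>
    fabs_lt (fsub (rat (↑↑x · ↑n)) (rat (↑↑x · (↑n + i)))) (fpow2 ↑n))).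

Definition real_le V (x y : tm V tp1) : fm V :=
  fall tp0 (fun n => fle (rat (↑x · n)) (fadd (rat (↑y · n)) (fpow2' n))).

Definition real_lt V (x y : tm V tp1) : fm V :=
  fex tp0 (fun n => flt (fadd (rat (↑x · n)) (fpow2' n)) (rat (↑y · n))).

(** |x - y| < e, where the real number |x - y| is the sequence of the rationals
    |x_(n+1) - y_(n+1)|: for some n, |x_(n+1) - y_(n+1)| + 2^(-n+1) < e_n. *)
Definition real_dist_lt V (x y e : tm V tp1) : fm V :=
  fex tp0 (fun n =>
    fabs_lt (fsub (rat (↑x · (n + 1))) (rat (↑y · (n + 1))))
            (fsub (rat (↑e · n)) (fpow2' n))).

Definition real_of_rat V (q : tm V tp0) : tm V tp1 := Pi · q.

Definition in_unit_interval V (x : tm V tp1) : fm V :=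
  is_real x /\ real_le (real_of_rat 0) x
            /\ real_le x (real_of_rat (rat_code 1 0 0)).

(** [D] and [R] are characteristic functions of a subset of Baire space and of
    a binary relation on it; [R] is curried. *)

Definition mem V (D : tm V tp2) (f : tm V tp1) : fm V := D · f = 1.
Definition rel V (R : tm V (tp1 ~> tp1 ~> tp0)) (f g : tm V tp1) : fm V :=
  R · f · g = 1.

Definition all_in V (D : tm V tp2)
    (b : tm (ext V tp1) tp1 -> fm (ext V tp1)) : fm V :=
  fall tp1 (fun f => mem ↑D f ==> b f).
Definition ex_in V (D : tm V tp2)
    (b : tm (ext V tp1) tp1 -> fm (ext V tp1)) : fm V :=
  fex tp1 (fun f => mem ↑D f /\ b f).

Definition is_charfun1 V (D : tm V tp2) : fm V :=
  fall tp1 (fun f => ↑D · f <= 1).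
Definition is_charfun2 V (R : tm V (tp1 ~> tp1 ~> tp0)) : fm V :=
  fall tp1 (fun f => fall tp1 (fun g => ↑↑R · ↑f · g <= 1)).

Definition directed V (D : tm V tp2) (R : tm V (tp1 ~> tp1 ~> tp0)) : fm V :=
  fex tp1 (fun f => mem ↑D f)
  /\ all_in D (fun f => all_in ↑D (fun g => all_in ↑↑D (fun h =>
       rel ↑↑↑R ↑↑f ↑g ==> rel ↑↑↑R ↑g h ==> rel ↑↑↑R ↑↑f h)))
  /\ all_in D (fun f => rel ↑R f f)
  /\ all_in D (fun f => all_in ↑D (fun g => ex_in ↑↑D (fun h =>
       rel ↑↑↑R ↑↑f h /\ rel ↑↑↑R ↑g h))).

Definition net_increasing V (D : tm V tp2) (R : tm V (tp1 ~> tp1 ~> tp0))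
    (x : tm V (tp1 ~> tp1)) : fm V :=
  all_in D (fun a => all_in ↑D (fun b =>
    rel ↑↑R ↑a b ==> real_le (↑↑x · ↑a) (↑↑x · b))).

Definition net_converges V (D : tm V tp2) (R : tm V (tp1 ~> tp1 ~> tp0))
    (x : tm V (tp1 ~> tp1)) (y : tm V tp1) : fm V :=
  fall tp1 (fun eps => is_real eps ==> real_lt (real_of_rat 0) eps ==>
    ex_in ↑D (fun d => all_in ↑↑D (fun e =>
      rel ↑↑↑R ↑d e ==> real_dist_lt (↑↑↑x · e) ↑↑↑y ↑↑eps))).

Definition seq_increasing V (x : tm V (tp0 ~> tp1)) : fm V :=
  fall tp0 (fun m => fall tp0 (fun n =>
    ↑m <= n ==> real_le (↑↑x · ↑m) (↑↑x · n))).

Definition seq_converges V (x : tm V (tp0 ~> tp1)) (y : tm V tp1) : fm V :=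
  fall tp1 (fun eps => is_real eps ==> real_lt (real_of_rat 0) eps ==>
    fex tp0 (fun m => fall tp0 (fun n =>
      ↑m <= n ==> real_dist_lt (↑↑↑x · n) ↑↑↑y ↑↑eps))).

Definition SUB0_body V (D : tm V tp2) (R : tm V (tp1 ~> tp1 ~> tp0))
    (x : tm V (tp1 ~> tp1)) (y : tm V tp1) : fm V :=
  is_charfun1 D ==> is_charfun2 R ==> directed D R ==>
  all_in D (fun d => in_unit_interval (↑x · d)) ==>
  net_increasing D R x ==>
  in_unit_interval y ==>
  net_converges D R x y ==>
  fex (tp0 ~> tp1) (fun Phi =>
    fall tp0 (fun n => mem ↑↑D (↑Phi · n))
    /\ seq_increasing (fn tp0 (fun n => ↑↑x · (↑Phi · n)))
    /\ seq_converges (fn tp0 (fun n => ↑↑x · (↑Phi · n))) ↑y).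

Definition SUB0 V : fm V :=
  fall tp2 (fun D => fall (tp1 ~> tp1 ~> tp0) (fun R =>
  fall (tp1 ~> tp1) (fun x => fall tp1 (fun y =>
    SUB0_body ↑↑↑D ↑↑R ↑x y)))).
Arguments SUB0 {V}.

Definition vars (_ : ty) : Set := nat.

(* Main.v *)
(** The calculus is complete for many-sorted structures whose equality is
    extensional, so it suffices to derive QF-AC^{0,1} from SUB_0 in an arbitrary
    model [M] of the axioms, which may be nonstandard.  There a quantifier-free [A]
    has a characteristic functional [a], and codes [w] of finite sequences with
    A(i, w_i) for all i < |w| form a set directed by |v| <= |w|.  The net
    |w| / (|w| + 1) increases to 1, because full induction yields such sequences of
    every length.  A subsequence Phi converging to 1 contains arbitrarily long
    sequences, so QF-AC^{1,0} yields g with |Phi(g(k))| > k, and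
    k |-> Phi(g(k))_k is the required choice function. *)

Require Import Defs.
From Stdlib Require Import List Lia Cantor Classical ClassicalEpsilon
  FunctionalExtensionality PropExtensionality ProofIrrelevance Ring.
Import ListNotations.

Set Implicit Arguments.
Unset Strict Implicit.
Unset Printing Implicit Defensive.

Implicit Types U V W : ty -> Set.

(** * Substitution *)

(** A direct derivation would have to carry pairing, square roots, rationals and sequence coding
    through de Bruijn syntax; in a model they become equations for rewriting and [ring]. The price
    is that induction holds there only for properties given by a formula, and each use must exhibit
    one. That choice sequences of every length exist is an existential statement about type 1
    objects, so quantifier-free induction does not cover it.

    Since only lengths are compared, any two indices are comparable, and different sequences may
    disagree on common entries: the final choice reads a single entry from each. The value at length
    $l$ has distance $1/(l+1)$ from 1, so tolerance $1/(k+1)$ forces a length above $k$, just enough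
    for an entry with index $k$ to exist. Convergence gives such a sequence for each $k$ without a
    function producing it, and the available choice axiom takes type 1 arguments; so $k$ is read off
    as $f(0)$ and later supplied as a constant function. *)

Lemma sub_ext (V : ty -> Set) (D : ty -> Set) (f g : forall s, V s -> D s) :
  (forall s v, f s v = g s v) -> f = g.
Proof.
  intro H. apply functional_extensionality_dep; intro s.
  apply functional_extensionality; intro v. apply H.
Qed.

(** Renamings are substitutions by variables, so the composition laws below are proved for [tsubst]
    alone. *)
Lemma tren_tsubst V W (r : forall s, V s -> W s) s (t : tm V s) :
  tren r t = tsubst (fun s v => Var (r s v)) t.
Proof. induction t; simpl; congruence. Qed.

Lemma tsubst_tsubst U V W (f : forall s, U s -> tm V s)
    (g : forall s, V s -> tm W s) s (t : tm U s) :
  tsubst g (tsubst f t) = tsubst (fun s v => tsubst g (f s v)) t.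
Proof. induction t; simpl; congruence. Qed.

Lemma tsubst_Var V s (t : tm V s) : tsubst (fun _ v => Var v) t = t.
Proof. induction t; simpl; congruence. Qed.

Lemma tsubst_shift V W r (f : forall s, ext V r s -> tm W s) s (t : tm V s) :
  tsubst f (shift r t) = tsubst (fun s v => f s (there v)) t.
Proof.
  unfold shift. now rewrite tren_tsubst, tsubst_tsubst.
Qed.

Lemma shift_tsubst V W r (f : forall s, V s -> tm W s) s (t : tm V s) :
  shift r (tsubst f t) = tsubst (fun s v => shift r (f s v)) t.
Proof.
  unfold shift. rewrite tren_tsubst, tsubst_tsubst. f_equal.
  apply sub_ext; intros. now rewrite tren_tsubst.
Qed.

Lemma up_comp U V W (f : forall s, U s -> tm V s) (g : forall s, V s -> tm W s) r :
  (fun s v => tsubst (up g (r := r)) (up f v))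
  = up (fun s v => tsubst g (f s v)) (r := r) :> (forall s, ext U r s -> _).
Proof.
  apply sub_ext; intros s v; destruct v; simpl; trivial.
  now rewrite tsubst_shift, shift_tsubst.
Qed.

Lemma up_Var V r :
  up (fun s v => Var v) (r := r) = (fun s v => Var v) :> (forall s, ext V r s -> _).
Proof. apply sub_ext; intros s v; now destruct v. Qed.

Lemma subst_subst U (p : fm U) : forall V W (f : forall s, U s -> tm V s)
    (g : forall s, V s -> tm W s),
  subst g (subst f p) = subst (fun s v => tsubst g (f s v)) p.
Proof.
  induction p; intros; simpl; rewrite ?tsubst_tsubst, ?IHp1, ?IHp2, ?IHp, ?up_comp;
    trivial.
Qed.

Lemma subst_Var V (p : fm V) : subst (fun _ v => Var v) p = p.
Proof.
  induction p; simpl; rewrite ?tsubst_Var, ?up_Var; congruence.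
Qed.

Lemma subst_inst V W (f : forall s, V s -> tm W s) r (t : tm V r) p :
  subst f (inst t p) = inst (tsubst f t) (subst (up f (r := r)) p).
Proof.
  unfold inst. rewrite !subst_subst. f_equal.
  apply sub_ext; intros s v; destruct v; simpl; trivial.
  now rewrite tsubst_shift, tsubst_Var.
Qed.

Lemma subst_fshift V W (f : forall s, V s -> tm W s) r p :
  subst (up f (r := r)) (fshift r p) = fshift r (subst f p).
Proof.
  unfold fshift. rewrite !subst_subst. f_equal.
  apply sub_ext; intros s v. simpl. unfold shift. now rewrite tren_tsubst.
Qed.

Lemma inst_up V W (f : forall s, V s -> tm W s) r (t : tm W r) p :
  inst t (subst (up f (r := r)) p) = subst (scons t f) p.
Proof.
  unfold inst. rewrite subst_subst. f_equal.
  apply sub_ext; intros s v; destruct v; simpl; trivial.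
  now rewrite tsubst_shift, tsubst_Var.
Qed.

Lemma subst_eqt V W (f : forall s, V s -> tm W s) s (x y : tm V s) :
  subst f (eqt x y) = eqt (tsubst f x) (tsubst f y).
Proof.
  revert V W f x y; induction s as [|r IHr t IHt]; intros; simpl; trivial.
  rewrite IHt; simpl. now rewrite !tsubst_shift, !shift_tsubst.
Qed.

Lemma qf_subst V (p : fm V) : forall W (f : forall s, V s -> tm W s),
  qf p -> qf (subst f p).
Proof. induction p; simpl; intuition. Qed.

Lemma subst_induction V W (f : forall s, V s -> tm W s) A :
  subst f (induction A) = induction (subst (up f (r := tp0)) A).
Proof.
  unfold induction; simpl. rewrite subst_inst; simpl.
  rewrite !subst_subst. do 4 f_equal.
  apply (f_equal (fun h => subst h A)).
  apply sub_ext; intros s v; destruct v; simpl; trivial.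
  rewrite tsubst_shift. unfold shift. now rewrite tren_tsubst.
Qed.

Lemma subst_QFAC V W (f : forall s, V s -> tm W s) s t A :
  subst f (QFAC A) = QFAC (subst (up (up f (r := s)) (r := t)) A).
Proof.
  unfold QFAC; simpl. unfold Ex, Neg; simpl. rewrite !subst_subst. do 6 f_equal.
  apply sub_ext; intros u v; destruct v as [|u v]; simpl; trivial.
  destruct v as [|u v]; simpl; trivial.
  rewrite !tsubst_shift. simpl. unfold shift. now rewrite !tren_tsubst, tsubst_tsubst.
Qed.

(** Axioms may have free variables. Closure under substitution is what lets a derivation be
    instantiated, and what makes the term model satisfy an axiom under every assignment. *)
Definition subst_closed (T : forall V, fm V -> Prop) : Prop :=
  forall V W (f : forall s, V s -> tm W s) p, T V p -> T W (subst f p).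

Lemma RCA0w_IND_subst : subst_closed RCA0w_IND.
Proof.
  intros V W f p [H|H]; [left|right].
  - destruct H; rewrite ?subst_induction, ?subst_QFAC; try (constructor; now try apply qf_subst);
      simpl; rewrite ?subst_eqt, ?subst_inst; simpl; try solve [constructor].
  - destruct H. rewrite subst_induction. constructor.
Qed.

(** * Derivations: substitution, weakening and fresh variables *)

Section Calculus.

Variable T : forall V, fm V -> Prop.
Hypothesis T_subst : subst_closed T.

Lemma prv_subst V (H : list (fm V)) p : prv T H p ->
  forall W (f : forall s, V s -> tm W s), prv T (map (subst f) H) (subst f p).
Proof.
  induction 1; intros W f.
  - apply prv_ax. now apply T_subst.
  - apply prv_hyp. now apply in_map.
  - apply prv_impI. apply (IHprv W f).
  - eapply prv_impE; [apply (IHprv1 W f)|apply (IHprv2 W f)].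
  - apply prv_raa. apply (IHprv W f).
  - simpl. apply prv_allI.
    specialize (IHprv _ (up f (r := s))).
    rewrite map_map in *. erewrite map_ext; [apply IHprv|].
    intro; simpl. now rewrite subst_fshift.
  - rewrite subst_inst. apply prv_allE. apply (IHprv W f).
Qed.

Lemma prv_weak V (H : list (fm V)) p : prv T H p ->
  forall H', incl H H' -> prv T H' p.
Proof.
  induction 1; intros H' I.
  - now apply prv_ax.
  - apply prv_hyp; auto.
  - apply prv_impI, IHprv. intros q' [->|K]; [now left|right; auto].
  - eapply prv_impE; eauto.
  - apply prv_raa, IHprv. intros q' [->|K]; [now left|right; auto].
  - apply prv_allI, IHprv. now apply incl_map.
  - apply prv_allE; auto.
Qed.

Lemma prv_exfalso V (H : list (fm V)) p : prv T H Bot -> prv T H p.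
Proof.
  intro A. apply prv_raa. eapply prv_weak; [exact A|]. now right.
Qed.

Fixpoint tocc V (P : forall s, V s -> Prop) s (t : tm V s) : Prop :=
  match t with
  | Var v => P _ v
  | App f a => tocc P f /\ tocc P a
  | _ => True
  end.

Definition lift V r (P : forall s, V s -> Prop) s (v : ext V r s) : Prop :=
  match v with here => True | there v => P _ v end.

Fixpoint focc V (P : forall s, V s -> Prop) (p : fm V) : Prop :=
  match p with
  | Bot => True
  | Eq a b | Lt a b => tocc P a /\ tocc P b
  | Imp p q => focc P p /\ focc P q
  | All s p => focc (@lift V s P) p
  end.

Lemma tsubst_occ V W (P : forall s, V s -> Prop) (f g : forall s, V s -> tm W s) :
  (forall s v, P s v -> f s v = g s v) ->
  forall s (t : tm V s), tocc P t -> tsubst f t = tsubst g t.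
Proof.
  intros E; induction t; simpl; intros; auto.
  rewrite IHt1, IHt2; tauto.
Qed.

Lemma subst_occ V (p : fm V) : forall W (P : forall s, V s -> Prop)
    (f g : forall s, V s -> tm W s),
  (forall s v, P s v -> f s v = g s v) -> focc P p -> subst f p = subst g p.
Proof.
  induction p; simpl; intros W P f g E O; trivial.
  - f_equal; eapply tsubst_occ; try eassumption; apply O.
  - f_equal; eapply tsubst_occ; try eassumption; apply O.
  - f_equal; [eapply IHp1|eapply IHp2]; try eassumption; apply O.
  - f_equal; eapply IHp; [|exact O].
    intros r v; destruct v; simpl; trivial. intro K. now rewrite E.
Qed.

Lemma tocc_mono V (P Q : forall s, V s -> Prop) (PQ : forall s v, P s v -> Q s v)
    s (t : tm V s) : tocc P t -> tocc Q t.
Proof. induction t; simpl; intuition. Qed.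

Lemma focc_mono V (p : fm V) : forall (P Q : forall s, V s -> Prop),
  (forall s v, P s v -> Q s v) -> focc P p -> focc Q p.
Proof.
  induction p; simpl; intros P Q PQ; trivial.
  - intros []; split; eapply tocc_mono; eassumption.
  - intros []; split; eapply tocc_mono; eassumption.
  - intros []; split; [eapply IHp1|eapply IHp2]; eassumption.
  - eapply IHp. intros r v; destruct v; simpl; auto.
Qed.

Lemma tocc_bounded V (P : nat -> forall s, V s -> Prop) :
  (forall m n s v, m <= n -> P m s v -> P n s v) ->
  (forall s v, exists n, P n s v) ->
  forall s (t : tm V s), exists n, tocc (P n) t.
Proof.
  intros P_mono P_all; induction t; simpl; try (now exists O); auto.
  destruct IHt1 as [m IH1], IHt2 as [n IH2]. exists (max m n). split.
  - eapply tocc_mono, IH1. intros; eapply P_mono; [|eassumption]. lia.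
  - eapply tocc_mono, IH2. intros; eapply P_mono; [|eassumption]. lia.
Qed.
(** Stated for an arbitrary increasing family of predicates exhausting the variables, so that the
    induction passes under a quantifier, where the family becomes its [lift]. *)
Lemma focc_bounded V (p : fm V) : forall (P : nat -> forall s, V s -> Prop),
  (forall m n s v, m <= n -> P m s v -> P n s v) ->
  (forall s v, exists n, P n s v) -> exists n, focc (P n) p.
Proof.
  induction p; simpl; intros P Pm Pa.
  - now exists O.
  - destruct (tocc_bounded Pm Pa t) as [m A], (tocc_bounded Pm Pa t0) as [n B].
    exists (max m n). split; [eapply tocc_mono, A|eapply tocc_mono, B];
      intros; eapply Pm; try eassumption; lia.
  - destruct (tocc_bounded Pm Pa t) as [m A], (tocc_bounded Pm Pa t0) as [n B].
    exists (max m n). split; [eapply tocc_mono, A|eapply tocc_mono, B];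
      intros; eapply Pm; try eassumption; lia.
  - destruct (IHp1 P Pm Pa) as [m A], (IHp2 P Pm Pa) as [n B].
    exists (max m n). split; [eapply focc_mono, A|eapply focc_mono, B];
      intros; eapply Pm; try eassumption; lia.
  - apply (IHp (fun n => @lift V s (P n))).
    + intros m n r v; destruct v; simpl; eauto.
    + intros r v; destruct v; simpl; [now exists O|apply Pa].
Qed.

Definition below (N : nat) (s : ty) (v : vars s) : Prop := v < N.

Lemma focc_below (p : fm vars) : exists N, focc (below N) p.
Proof.
  apply focc_bounded with (P := below); unfold below; [lia|].
  intros s v; exists (S v); lia.
Qed.

Lemma focc_below_list (H : list (fm vars)) : exists N, Forall (focc (below N)) H.
Proof.
  induction H as [|p H [N IH]]; [now exists O|].
  destruct (focc_below p) as [M A]. exists (max M N). constructor.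
  - eapply focc_mono, A. unfold below; lia.
  - eapply Forall_impl, IH. intro q. apply focc_mono. unfold below; lia.
Qed.

Definition ty_eq_dec (s t : ty) : {s = t} + {s <> t}.
Proof. decide equality. Defined.

(** Inverse to instantiation by [Var k]: the named variable [k] of type [r] becomes the bound
    variable, all others are shifted. *)
Definition bind_var (r : ty) (k : nat) s (v : vars s) : tm (ext vars r) s :=
  match ty_eq_dec r s with
  | left e => if Nat.eqb v k then eq_rect r (tm (ext vars r)) (Var here) s e
              else Var (there v)
  | right _ => Var (there v)
  end.

Lemma bind_var_same r k : bind_var r k (k : vars r) = Var here.
Proof.
  unfold bind_var. destruct (ty_eq_dec r r) as [e|n]; [|easy].
  rewrite PeanoNat.Nat.eqb_refl. now rewrite (proof_irrelevance _ e eq_refl).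
Qed.

Lemma bind_var_below r k s v : below k v -> bind_var r k (v : vars s) = Var (there v).
Proof.
  unfold below, bind_var; intro L. destruct (ty_eq_dec r s); trivial.
  destruct (PeanoNat.Nat.eqb_spec v k); trivial. lia.
Qed.

(** The eigenvariable rule for a named variable. Substituting [bind_var r k] throughout the
    derivation turns the instance back into [p] and, [k] being fresh, merely shifts the hypotheses.
    As [vars] has infinitely many variables of each type, they can serve as Henkin constants. *)
Lemma prv_fresh (H : list (fm vars)) r (p : fm (ext vars r)) k :
  Forall (focc (below k)) H -> focc (below k) (All r p) ->
  prv T H (inst (Var (k : vars r)) p) -> prv T H (All r p).
Proof.
  intros FH Fp A. apply prv_allI.
  apply (@prv_subst vars _ _) with (f := bind_var r k) in A.
  replace (map (fshift r) H) with (map (subst (bind_var r k)) H).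
  replace p with (subst (bind_var r k) (inst (Var (k : vars r)) p)); trivial.
  - unfold inst. rewrite subst_subst. rewrite <- (subst_Var p) at 2.
    eapply subst_occ; [|exact Fp].
    intros s v; destruct v; simpl; intro B.
    + apply bind_var_same.
    + now apply bind_var_below.
  - apply map_ext_in. intros q Q. rewrite Forall_forall in FH.
    eapply subst_occ; [|apply FH, Q]. intros; now apply bind_var_below.
Qed.

End Calculus.

(** * The language is countable *)

Definition cp (m n : nat) : nat := to_nat (m, n).

Lemma cp_inj a b c d : cp a b = cp c d -> a = c /\ b = d.
Proof. intro H. unfold cp in H. apply to_nat_inj in H. now injection H. Qed.

Fixpoint ty_code (s : ty) : nat :=
  match s with tp0 => 0 | s ~> t => S (cp (ty_code s) (ty_code t)) end.

Lemma ty_code_inj s t : ty_code s = ty_code t -> s = t.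
Proof.
  revert t; induction s; destruct t; simpl; try easy.
  intro H. injection H as H. apply cp_inj in H as [A B]. f_equal; auto.
Qed.

Fixpoint tm_code V (c : forall s, V s -> nat) s (t : tm V s) : nat :=
  match t with
  | Var v => cp 0 (c _ v)
  | App f a => cp 1 (cp (tm_code c f) (tm_code c a))
  | Zero => cp 2 0
  | One => cp 3 0
  | Plus => cp 4 0
  | Times => cp 5 0
  | @Pi _ s t => cp 6 (cp (ty_code s) (ty_code t))
  | @Sigma _ r s t => cp 7 (cp (ty_code r) (cp (ty_code s) (ty_code t)))
  | Rec => cp 8 0
  end.

Definition ext_code V r (c : forall s, V s -> nat) s (v : ext V r s) : nat :=
  match v with here => 0 | there v => S (c _ v) end.

Fixpoint fm_code V (c : forall s, V s -> nat) (p : fm V) : nat :=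
  match p with
  | Bot => cp 0 0
  | Eq a b => cp 1 (cp (tm_code c a) (tm_code c b))
  | Lt a b => cp 2 (cp (tm_code c a) (tm_code c b))
  | Imp p q => cp 3 (cp (fm_code c p) (fm_code c q))
  | All s p => cp 4 (cp (ty_code s) (fm_code (@ext_code V s c) p))
  end.

Definition inj_code V (c : forall s, V s -> nat) : Prop :=
  forall s (v : V s) s' (v' : V s'), c s v = c s' v' -> existT V s v = existT V s' v'.

Lemma inj_code_ext V r (c : forall s, V s -> nat) :
  inj_code c -> inj_code (@ext_code V r c).
Proof.
  intros C s v s' v'. destruct v as [|s v], v' as [|s' v']; simpl; try easy.
  intro H. injection H as H. apply C in H.
  apply (f_equal (fun x => existT (ext V r) (projT1 x) (there (projT2 x))) H).
Qed.

Ltac cp_split :=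
  repeat match goal with
  | H : cp _ _ = cp _ _ |- _ => apply cp_inj in H as [? H]
  | H : ?x = ?x |- _ => clear H
  | H : ty_code _ = ty_code _ |- _ => apply ty_code_inj in H
  end.

(** Terms of possibly different types are compared, hence the dependent pairs. The code of an
    application does not mention the type of the argument; it is recovered from the type of the
    function. *)
Lemma tm_code_inj V (c : forall s, V s -> nat) : inj_code c ->
  forall s (t : tm V s) s' (t' : tm V s'),
  tm_code c t = tm_code c t' -> existT (tm V) s t = existT (tm V) s' t'.
Proof.
  intros C; induction t; intros s' t' H; destruct t'; simpl in H;
    cp_split; try discriminate; trivial.
  - apply C in H.
    apply (f_equal (fun x => existT (tm V) (projT1 x) (Var (projT2 x))) H).
  - match goal with H1 : tm_code c t2 = _, H2 : tm_code c t3 = _ |- _ =>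
      apply IHt1 in H1 as E1; apply IHt2 in H2 as E2 end.
    pose proof (f_equal (@projT1 _ _) E1) as E; simpl in E. injection E as -> ->.
    apply inj_pair2 in E1. apply inj_pair2 in E2. now subst.
  - now subst.
  - now subst.
Qed.

Lemma fm_code_inj V (p : fm V) : forall (c : forall s, V s -> nat), inj_code c ->
  forall q, fm_code c p = fm_code c q -> p = q.
Proof.
  induction p; intros c C q H; destruct q; simpl in H; cp_split; try discriminate; trivial.
  - repeat match goal with H : tm_code _ _ = tm_code _ _ |- _ =>
      apply (tm_code_inj C), inj_pair2 in H end. now subst.
  - repeat match goal with H : tm_code _ _ = tm_code _ _ |- _ =>
      apply (tm_code_inj C), inj_pair2 in H end. now subst.
  - f_equal; eauto.
  - subst. f_equal. eapply IHp; [|exact H].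
    now apply inj_code_ext.
Qed.

Definition var_code (s : ty) (v : vars s) : nat := cp (ty_code s) v.

Lemma var_code_inj : inj_code var_code.
Proof.
  intros s v s' v' H. apply cp_inj in H as [A B]. apply ty_code_inj in A. now subst.
Qed.

Definition fm_enum (n : nat) : fm vars :=
  epsilon (inhabits Bot) (fun p => fm_code var_code p = n).

Lemma fm_enum_surj p : exists n, fm_enum n = p.
Proof.
  exists (fm_code var_code p). apply (fm_code_inj var_code_inj).
  apply (epsilon_spec (inhabits Bot) (fun q => fm_code var_code q = fm_code var_code p)).
  now exists p.
Qed.

(** * Structures with extensional Leibniz equality, and completeness *)

(** The domains lie in [Set] so that [dom M] can itself be a family of variables. By [ap_ext] the
    defined equality [eqt] at higher types is interpreted as genuine equality. *)
Record structure := Structure {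
  dom : ty -> Set;
  ap : forall s t, dom (s ~> t) -> dom s -> dom t;
  czero : dom tp0;
  cone : dom tp0;
  cplus : dom (tp0 ~> tp0 ~> tp0);
  ctimes : dom (tp0 ~> tp0 ~> tp0);
  cpi : forall s t, dom (s ~> t ~> s);
  csigma : forall r s t, dom ((r ~> s ~> t) ~> (r ~> s) ~> r ~> t);
  crec : dom ((tp0 ~> tp0 ~> tp0) ~> tp0 ~> tp0 ~> tp0);
  clt : dom tp0 -> dom tp0 -> Prop;
  ap_ext : forall s t (f g : dom (s ~> t)), (forall a, ap f a = ap g a) -> f = g }.

Arguments czero {_}.
Arguments cone {_}.
Arguments cplus {_}.
Arguments ctimes {_}.
Arguments cpi {_ s t}.
Arguments csigma {_ r s t}.
Arguments crec {_}.

(** * Evaluation and satisfaction *)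

Section Semantics.
Variable M : structure.

Fixpoint eval V (e : forall s, V s -> dom M s) s (t : tm V s) : dom M s :=
  match t in tm _ s return dom M s with
  | Var v => e _ v
  | App f a => ap (eval e f) (eval e a)
  | Zero => czero
  | One => cone
  | Plus => cplus
  | Times => ctimes
  | Pi => cpi
  | Sigma => csigma
  | Rec => crec
  end.

Definition vcons V r (m : dom M r) (e : forall s, V s -> dom M s) s (v : ext V r s) :
    dom M s :=
  match v in ext _ _ s return dom M r -> dom M s with
  | here => fun m => m
  | there v => fun _ => e _ v
  end m.

Fixpoint sat V (e : forall s, V s -> dom M s) (p : fm V) : Prop :=
  match p with
  | Bot => False
  | Eq a b => eval e a = eval e b
  | Lt a b => clt (eval e a) (eval e b)
  | Imp p q => sat e p -> sat e q
  | All s p => forall m, sat (vcons (r := s) m e) p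
  end.

Lemma eval_tsubst V W (f : forall s, V s -> tm W s) (e : forall s, W s -> dom M s)
    s (t : tm V s) :
  eval e (tsubst f t) = eval (fun s v => eval e (f s v)) t.
Proof. induction t; simpl; congruence. Qed.

Lemma eval_shift V r (m : dom M r) (e : forall s, V s -> dom M s) s (t : tm V s) :
  eval (vcons m e) (shift r t) = eval e t.
Proof. unfold shift. now rewrite tren_tsubst, eval_tsubst. Qed.

Lemma sat_subst V (p : fm V) : forall W (f : forall s, V s -> tm W s)
    (e : forall s, W s -> dom M s),
  sat e (subst f p) <-> sat (fun s v => eval e (f s v)) p.
Proof.
  induction p; intros W f e; simpl; rewrite ?eval_tsubst; try reflexivity.
  - now rewrite IHp1, IHp2.
  - assert (E : forall m, (fun r (v : ext V s r) => eval (vcons m e) (up f v))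
                = vcons m (fun r v => eval e (f r v))).
    { intro m. apply sub_ext; intros r v; destruct v; simpl; trivial.
      apply eval_shift. }
    split; intros H m; specialize (H m).
    + now rewrite IHp, E in H.
    + now rewrite IHp, E.
Qed.

Lemma sat_inst V r (t : tm V r) (p : fm (ext V r)) (e : forall s, V s -> dom M s) :
  sat e (inst t p) <-> sat (vcons (eval e t) e) p.
Proof.
  unfold inst. rewrite sat_subst.
  replace (vcons (eval e t) e)
    with (fun s (v : ext V r s) => eval e (scons t (fun s v => Var v) v)); [reflexivity|].
  apply sub_ext; intros s v; now destruct v.
Qed.

Lemma sat_eqt V s (x y : tm V s) (e : forall s, V s -> dom M s) :
  sat e (eqt x y) <-> eval e x = eval e y.
Proof.
  revert V x y e; induction s as [|r IHr t IHt]; intros; simpl; [reflexivity|].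
  split.
  - intro H. apply ap_ext; intro a. specialize (H a).
    rewrite IHt in H; simpl in H. now rewrite !eval_shift in H.
  - intros H a. rewrite IHt; simpl. now rewrite !eval_shift, H.
Qed.

End Semantics.

(** * The Henkin construction of a term model *)

Section Henkin.

Variable T : forall V, fm V -> Prop.
Hypothesis T_subst : subst_closed T.
Hypothesis T_RCA0w : forall V (p : fm V), RCA0w p -> T p.
Variable phi : fm vars.
Hypothesis phi_unprovable : ~ prv T [] phi.

Definition con (H : list (fm vars)) : Prop := ~ prv T H Bot.

(** One step of the Henkin construction: a consistent extension that settles [p] and, if it accepts
    a negated universal formula, refutes an instance at some variable. *)
Definition decides (H : list (fm vars)) (p : fm vars) (H' : list (fm vars)) : Prop :=
  incl H H' /\ con H' /\ (prv T H' p \/ prv T H' (Neg p)) /\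
  forall s q, p = Neg (All s q) -> prv T H' p ->
    exists k : vars s, prv T H' (Neg (inst (Var k) q)).

Lemma prv_contra V (H : list (fm V)) p : prv T H p -> prv T H (Neg p) -> prv T H Bot.
Proof. intros A B. eapply prv_impE; [exact B|exact A]. Qed.

(** If [H] does not refute [p], then [p] can be added consistently. When [p] is a negated universal
    formula, a refuted instance at a fresh variable is added too: if that were inconsistent, the
    instance would be provable, hence by [prv_fresh] the universal formula as well. *)
Lemma decides_ex H p : con H -> exists H', decides H p H'.
Proof.
  intro C. destruct (classic (prv T H (Neg p))) as [N|N].
  - exists H. repeat split; auto using incl_refl.
    intros s q -> A. destruct C. eapply prv_contra; eassumption.
  - assert (C' : con (p :: H)) by (intro B; apply N, prv_impI, B).
    destruct (classic (exists s q, p = Neg (All s q))) as [(s & q & ->)|K].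
    + destruct (focc_below_list (All s q :: Neg (All s q) :: H)) as [k F].
      inversion_clear F as [|? ? F1 F2].
      exists (Neg (inst (Var (k : vars s)) q) :: Neg (All s q) :: H). repeat split.
      * intros r R. now do 2 right.
      * intro B. apply C'. eapply prv_contra with (p := All s q).
        -- eapply prv_fresh; try eassumption. now apply prv_raa.
        -- apply prv_hyp. now left.
      * left. apply prv_hyp. right. now left.
      * intros s' q' E _. exists k. injection E as <- E. apply inj_pair2 in E as <-.
        apply prv_hyp. now left.
    + exists (p :: H). repeat split; trivial.
      * intros r R. now right.
      * left. apply prv_hyp. now left.
      * intros s q E. destruct K. now exists s, q.
Qed.

Fixpoint stage (n : nat) : list (fm vars) :=
  match n with
  | O => [Neg phi]
  | S n => epsilon (inhabits []) (decides (stage n) (fm_enum n))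
  end.

Lemma stage_con n : con (stage n).
Proof.
  induction n; simpl.
  - intro B. apply phi_unprovable. now apply prv_raa.
  - apply (epsilon_spec (inhabits []) (decides (stage n) (fm_enum n))).
    now apply decides_ex.
Qed.

Lemma stage_decides n : decides (stage n) (fm_enum n) (stage (S n)).
Proof.
  apply (epsilon_spec (inhabits []) (decides (stage n) (fm_enum n))).
  apply decides_ex, stage_con.
Qed.

Lemma stage_mono m n : m <= n -> incl (stage m) (stage n).
Proof.
  induction 1; [apply incl_refl|].
  eapply incl_tran; [exact IHle|]. apply stage_decides.
Qed.

Definition Th (p : fm vars) : Prop := exists n, prv T (stage n) p.

Lemma Th_join p q : Th p -> Th q -> exists n, prv T (stage n) p /\ prv T (stage n) q.
Proof.
  intros [m A] [n B]. exists (max m n).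
  split; eapply prv_weak; try eassumption; apply stage_mono; lia.
Qed.

Lemma Th_ax p : T p -> Th p.
Proof. intro A. exists 0. now apply prv_ax. Qed.

Lemma Th_Bot : ~ Th Bot.
Proof. intros [n A]. now apply (stage_con A). Qed.

Lemma Th_Neg p : Th (Neg p) <-> ~ Th p.
Proof.
  split.
  - intros A B. destruct (Th_join A B) as (n & C & D). apply Th_Bot. exists n.
    eapply prv_contra; eassumption.
  - intro A. destruct (fm_enum_surj p) as [n <-].
    destruct (stage_decides n) as (_ & _ & [B|B] & _).
    + destruct A. now exists (S n).
    + now exists (S n).
Qed.

Lemma Th_Imp p q : Th (Imp p q) <-> (Th p -> Th q).
Proof.
  split.
  - intros A B. destruct (Th_join A B) as (n & C & D). exists n.
    eapply prv_impE; eassumption.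
  - intro A. destruct (classic (Th p)) as [B|B].
    + destruct (A B) as [n C]. exists n. apply prv_impI.
      eapply prv_weak; [exact C|]. intros r R. now right.
    + apply Th_Neg in B as [n C]. exists n. apply prv_impI. apply prv_exfalso.
      eapply prv_contra; [apply prv_hyp; now left|].
      eapply prv_weak; [exact C|]. intros r R. now right.
Qed.

(** From right to left, a universal formula outside the theory has its negation inside; the stage
    that treats this negation refutes an instance at a variable. *)
Lemma Th_All s (p : fm (ext vars s)) : Th (All s p) <-> forall t, Th (inst t p).
Proof.
  split.
  - intros [n A] t. exists n. now apply prv_allE.
  - intro A. apply NNPP. intro N. apply Th_Neg in N as N'.
    destruct (fm_enum_surj (Neg (All s p))) as [n E].
    destruct (stage_decides n) as (_ & _ & D & W).
    destruct (W s p E) as [k K].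
    + rewrite E in *. destruct D as [D|D]; trivial.
      destruct (proj1 (Th_Neg (Neg (All s p)))); trivial. now exists (S n).
    + apply (proj1 (Th_Neg (inst (Var k) p))); [now exists (S n)|apply A].
Qed.

(** * The quotient of terms by equality in the theory *)

Fixpoint eqT (s : ty) : tm vars s -> tm vars s -> Prop :=
  match s return tm vars s -> tm vars s -> Prop with
  | tp0 => fun x y => Th (Eq x y)
  | r ~> t => fun x y => forall a, eqT (App x a) (App y a)
  end.

Lemma Th_eqt s (x y : tm vars s) : Th (eqt x y) <-> eqT x y.
Proof.
  induction s as [|r IHr t IHt]; simpl; [reflexivity|].
  rewrite Th_All. unfold inst.
  split; intros H a; specialize (H a);
    rewrite subst_eqt, IHt in *; simpl in *;
    rewrite !tsubst_shift, !tsubst_Var in *; exact H.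
Qed.

Lemma Th_refl (x : tm vars tp0) : Th (Eq x x).
Proof. apply Th_ax, T_RCA0w, ax_eq_refl. Qed.

Lemma Th_subst (x y : tm vars tp0) A : Th (Eq x y) -> Th (inst x A) -> Th (inst y A).
Proof.
  intros E. apply Th_Imp. revert E. apply Th_Imp. apply Th_ax, T_RCA0w, ax_eq_subst.
Qed.

Lemma eqT_refl s (x : tm vars s) : eqT x x.
Proof. induction s; simpl; [apply Th_refl|auto]. Qed.

Lemma eqT_sym s (x y : tm vars s) : eqT x y -> eqT y x.
Proof.
  induction s; simpl; [|auto]. intro E.
  apply (Th_subst (A := Eq (Var here) (shift _ x))) in E; revert E;
    unfold inst; simpl; rewrite !tsubst_shift, !tsubst_Var; auto using Th_refl.
Qed.

Lemma eqT_trans s (x y z : tm vars s) : eqT x y -> eqT y z -> eqT x z.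
Proof.
  induction s; simpl; [|eauto]. intros E F.
  apply (Th_subst (A := Eq (shift _ x) (Var here))) in F; revert F;
    unfold inst; simpl; rewrite !tsubst_shift, !tsubst_Var; auto.
Qed.

Lemma eqT_app s t (f g : tm vars (s ~> t)) (a b : tm vars s) :
  eqT f g -> eqT a b -> eqT (App f a) (App g b).
Proof.
  intros F A. apply eqT_trans with (App g a); [apply F|].
  apply Th_eqt. apply Th_eqt in A. revert A. apply Th_Imp.
  apply Th_ax, T_RCA0w, ax_ext.
Qed.

(** Equivalence classes as predicates would not live in [Set], so a class is represented by a chosen
    element. Equivalent terms have the same predicate [eqT t], so [epsilon] chooses the same term
    for both. *)
Definition rep s (t : tm vars s) : tm vars s :=
  epsilon (inhabits (Var (0 : vars s))) (eqT t).

Lemma rep_spec s (t : tm vars s) : eqT t (rep t).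
Proof.
  apply (epsilon_spec (inhabits (Var (0 : vars s))) (eqT t)). exists t. apply eqT_refl.
Qed.

Lemma rep_eq s (t u : tm vars s) : eqT t u -> rep t = rep u.
Proof.
  intro E. unfold rep. f_equal. apply functional_extensionality; intro x.
  apply propositional_extensionality; split; intro; eapply eqT_trans; eauto using eqT_sym.
Qed.

Definition qdom (s : ty) : Set := {t : tm vars s | rep t = t}.

Definition cls s (t : tm vars s) : qdom s :=
  exist _ (rep t) (eq_sym (rep_eq (rep_spec t))).

Lemma cls_eq s (t u : tm vars s) : cls t = cls u <-> eqT t u.
Proof.
  split; intro E.
  - apply (f_equal (@proj1_sig _ _)) in E; simpl in E.
    eapply eqT_trans; [apply rep_spec|]. rewrite E. apply eqT_sym, rep_spec.
  - apply rep_eq in E. unfold cls.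
    apply eq_sig_hprop; [intros; apply proof_irrelevance|exact E].
Qed.

Lemma cls_surj s (m : qdom s) : m = cls (proj1_sig m).
Proof.
  destruct m as [t E]; simpl. apply eq_sig_hprop; [intros; apply proof_irrelevance|].
  exact (eq_sym E).
Qed.

Definition qap s t (f : qdom (s ~> t)) (a : qdom s) : qdom t :=
  cls (App (proj1_sig f) (proj1_sig a)).

Lemma qap_cls s t (f : tm vars (s ~> t)) (a : tm vars s) :
  qap (cls f) (cls a) = cls (App f a).
Proof. apply cls_eq. apply eqT_app; apply eqT_sym, rep_spec. Qed.

(** Extensionality is built into [eqT], which at an arrow type quantifies over all terms as
    arguments, and every element of the domain is the class of a term. *)
Lemma qap_ext s t (f g : qdom (s ~> t)) : (forall a, qap f a = qap g a) -> f = g.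
Proof.
  rewrite (cls_surj f), (cls_surj g). intro E. apply cls_eq. intro a.
  specialize (E (cls a)). rewrite !qap_cls in E. now apply cls_eq in E.
Qed.

Definition term_model : structure := {|
  dom := qdom;
  ap := qap;
  czero := cls 0%tm;
  cone := cls 1%tm;
  cplus := cls Plus;
  ctimes := cls Times;
  cpi := fun s t => cls Pi;
  csigma := fun r s t => cls Sigma;
  crec := cls Rec;
  clt := fun x y => Th (Lt (proj1_sig x) (proj1_sig y));
  ap_ext := qap_ext |}.

Lemma eval_cls V (f : forall s, V s -> tm vars s) s (t : tm V s) :
  eval (M := term_model) (fun s v => cls (f s v)) t = cls (tsubst f t).
Proof.
  induction t; trivial. simpl. rewrite IHt1, IHt2. apply qap_cls.
Qed.

Lemma Th_Lt_eqT (a a' b b' : tm vars tp0) :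
  eqT a a' -> eqT b b' -> Th (Lt a b) -> Th (Lt a' b').
Proof.
  intros E F L.
  apply (Th_subst (A := Lt (Var here) (shift _ b))) in E.
  - apply (Th_subst (A := Lt (shift _ a') (Var here))) in F; revert E F;
    unfold inst; simpl; rewrite !tsubst_shift, !tsubst_Var; auto.
  - unfold inst; simpl; rewrite !tsubst_shift, !tsubst_Var; auto.
Qed.

(** The truth lemma. An assignment is given by a substitution, so passing under a quantifier extends
    the substitution by one more term. *)
Lemma sat_cls V (p : fm V) : forall (f : forall s, V s -> tm vars s),
  sat (M := term_model) (fun s v => cls (f s v)) p <-> Th (subst f p).
Proof.
  induction p; intro f; simpl.
  - split; [easy|apply Th_Bot].
  - rewrite !eval_cls. apply cls_eq.
  - rewrite !eval_cls.
    split; apply Th_Lt_eqT; first [apply rep_spec | apply eqT_sym, rep_spec].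
  - rewrite Th_Imp, IHp1, IHp2. reflexivity.
  - rewrite Th_All.
    assert (E : forall t, vcons (M := term_model) (cls t) (fun s v => cls (f s v))
                = (fun r (v : ext V s r) => cls (scons t f v))).
    { intro t. apply sub_ext; intros r v; now destruct v. }
    split.
    + intros H t. rewrite inst_up, <- IHp, <- E. apply H.
    + intros H m. rewrite (cls_surj m), E, IHp, <- inst_up. apply H.
Qed.

Lemma henkin : exists M : structure,
  (forall V (p : fm V), T p -> forall e : forall s, V s -> dom M s, sat e p) /\
  exists e : forall s, vars s -> dom M s, ~ sat e phi.
Proof.
  exists term_model. split.
  - intros V p A e.
    (* Every assignment comes from the substitution by representatives, and substitution instances
       of axioms are axioms. *)
    replace e with (fun s v => cls (proj1_sig (e s v))).
    + apply sat_cls, Th_ax, T_subst, A.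
    + apply sub_ext; intros; symmetry; apply cls_surj.
  - exists (fun s v => cls (Var v)). rewrite sat_cls, subst_Var.
    apply Th_Neg. exists 0. apply prv_hyp. now left.
Qed.

End Henkin.

Lemma completeness (phi : fm vars) :
  (forall M : structure,
    (forall V (p : fm V), RCA0w_IND p -> forall e : forall s, V s -> dom M s, sat e p) ->
    forall e : forall s, vars s -> dom M s, sat e phi) ->
  prv RCA0w_IND [] phi.
Proof.
  intro H. apply NNPP; intro N.
  destruct (henkin RCA0w_IND_subst (fun V p A => or_introl A) N) as (M & A & e & B).
  apply B, H, A.
Qed.

(** * Arithmetic in a model *)

Declare Scope m_scope.
Delimit Scope m_scope with m.
Notation "f · a" := (ap f a) (at level 25, left associativity) : m_scope.
Notation "a + b" := (ap (ap cplus a) b) : m_scope.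
Notation "a * b" := (ap (ap ctimes a) b) : m_scope.
Notation "0" := czero : m_scope.
Notation "1" := cone : m_scope.
Notation "a < b" := (clt a b) : m_scope.
Notation "a <= b" := (clt a b \/ a = b) : m_scope.

Lemma all_iff (X : Type) (P Q : X -> Prop) :
  (forall x, P x <-> Q x) -> (forall x, P x) <-> (forall x, Q x).
Proof. firstorder. Qed.

Lemma imp_iff (P Q R : Prop) : (Q <-> R) -> (P -> Q) <-> (P -> R).
Proof. tauto. Qed.

Lemma ex_iff (X : Type) (P Q : X -> Prop) :
  (forall x, P x <-> Q x) -> (exists x, P x) <-> (exists x, Q x).
Proof. firstorder. Qed.

Section Model.

Variable M : structure.
Hypothesis HM : forall V (p : fm V), RCA0w_IND p ->
  forall e : forall s, V s -> dom M s, sat e p.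

Local Open Scope m_scope.

Notation N := (dom M tp0).

(** Elements of the model serve as variables, so terms and formulas with
    parameters in the model live in [tm (dom M)] and [fm (dom M)]. *)
Definition param s (v : dom M s) : dom M s := v.

Lemma RCA0w_sat V (p : fm V) (e : forall s, V s -> dom M s) : RCA0w p -> sat e p.
Proof. intro H. apply HM. now left. Qed.

Lemma sat_and V (e : forall s, V s -> dom M s) p q :
  sat e (And p q) <-> sat e p /\ sat e q.
Proof. simpl. split; [intro; split; apply NNPP|]; tauto. Qed.

Lemma sat_or V (e : forall s, V s -> dom M s) p q :
  sat e (Or p q) <-> sat e p \/ sat e q.
Proof. simpl. destruct (classic (sat e p)); tauto. Qed.

Lemma sat_ex V (e : forall s, V s -> dom M s) s p :
  sat e (Ex s p) <-> exists m, sat (vcons m e) p.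
Proof.
  simpl. split.
  - intro H. apply NNPP. intro K. apply H. intros m A. apply K. now exists m.
  - intros [m A] K. exact (K m A).
Qed.

Lemma cpi_ap s t (x : dom M s) (y : dom M t) : cpi · x · y = x.
Proof.
  pose proof (RCA0w_sat (p := eqt (Pi · Var x · Var y)%tm (Var x)) param) as H.
  rewrite sat_eqt in H. apply H. constructor.
Qed.

Lemma csigma_ap r s t (x : dom M (r ~> s ~> t)) (y : dom M (r ~> s)) (z : dom M r) :
  csigma · x · y · z = x · z · (y · z).
Proof.
  pose proof (RCA0w_sat (p := eqt (Sigma · Var x · Var y · Var z)
    (Var x · Var z · (Var y · Var z))) param) as H.
  rewrite sat_eqt in H. apply H. constructor.
Qed.

Lemma eval_lam V (e : forall s, V s -> dom M s) s t (b : tm (ext V s) t) m :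
  eval e (lam b) · m = eval (vcons m e) b.
Proof.
  induction b as [t v| | | | | | | |]; simpl; rewrite ?cpi_ap; trivial.
  - destruct v; simpl; rewrite ?csigma_ap, ?cpi_ap; trivial.
  - now rewrite csigma_ap, IHb1, IHb2.
Qed.

Lemma eval_fn V (e : forall s, V s -> dom M s) s t
    (b : tm (ext V s) s -> tm (ext V s) t) m :
  eval e (fn s b) · m = eval (vcons m e) (b (Var here)).
Proof. apply eval_lam. Qed.

Lemma crec_0 f (m : N) : crec · f · m · 0 = m.
Proof. exact (RCA0w_sat param (ax_Rec0 (Var f) (Var m))). Qed.

Lemma crec_S f (m n : N) : crec · f · m · (n + 1) = f · n · (crec · f · m · n).
Proof. exact (RCA0w_sat param (ax_RecS (Var f) (Var m) (Var n))). Qed.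

(** The elements of type 0 may be nonstandard, so [P] has to be defined by a formula [A]; its
    parameters from the model occur as variables. *)
Lemma m_ind (P : N -> Prop) (A : fm (ext (dom M) tp0)) :
  (forall n, sat (vcons n param) A <-> P n) ->
  P 0 -> (forall n, P n -> P (n + 1)) -> forall n, P n.
Proof.
  intros HA H0 HS n.
  pose proof (HM (or_intror (ax_ind A)) param) as H. simpl in H.
  rewrite <- HA. apply H.
  - rewrite sat_inst. now apply HA.
  - intros k K. rewrite sat_subst. apply HA, HS, HA in K. revert K.
    replace (vcons (r := tp0) (k + 1) param) with
      (fun s (v : ext (dom M) tp0 s) => eval (vcons k param)
        (scons (Var here + 1)%tm (fun s v => Var (there v)) v)); trivial.
    apply sub_ext; intros s v; now destruct v.
Qed.

Lemma addA (a b c : N) : a + (b + c) = (a + b) + c.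
Proof. exact (RCA0w_sat param (ax_addA (Var a) (Var b) (Var c))). Qed.
Lemma addC (a b : N) : a + b = b + a.
Proof. exact (RCA0w_sat param (ax_addC (Var a) (Var b))). Qed.
Lemma add0 (a : N) : a + 0 = a.
Proof. exact (RCA0w_sat param (ax_add0 (Var a))). Qed.
Lemma mulA (a b c : N) : a * (b * c) = (a * b) * c.
Proof. exact (RCA0w_sat param (ax_mulA (Var a) (Var b) (Var c))). Qed.
Lemma mulC (a b : N) : a * b = b * a.
Proof. exact (RCA0w_sat param (ax_mulC (Var a) (Var b))). Qed.
Lemma mul0 (a : N) : a * 0 = 0.
Proof. exact (RCA0w_sat param (ax_mul0 (Var a))). Qed.
Lemma mul1 (a : N) : a * 1 = a.
Proof. exact (RCA0w_sat param (ax_mul1 (Var a))). Qed.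
Lemma mulDr (a b c : N) : a * (b + c) = a * b + a * c.
Proof. exact (RCA0w_sat param (ax_mulDr (Var a) (Var b) (Var c))). Qed.
Lemma lt_irrefl (a : N) : ~ a < a.
Proof. exact (RCA0w_sat param (ax_lt_irrefl (Var a))). Qed.
Lemma lt_trans (a b c : N) : a < b -> b < c -> a < c.
Proof. exact (RCA0w_sat param (ax_lt_trans (Var a) (Var b) (Var c))). Qed.
Lemma lt_total (a b : N) : a < b \/ a = b \/ b < a.
Proof.
  pose proof (RCA0w_sat param (ax_lt_total (Var a) (Var b))) as H.
  rewrite !sat_or in H. exact H.
Qed.
Lemma lt_add (a b c : N) : a < b -> a + c < b + c.
Proof. exact (RCA0w_sat param (ax_lt_add (Var a) (Var b) (Var c))). Qed.
Lemma ge0 (a : N) : 0 <= a.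
Proof.
  pose proof (RCA0w_sat param (ax_ge0 (Var a))) as H. rewrite sat_or in H. exact H.
Qed.
Lemma lt01 : 0 < (1 : N).
Proof. exact (RCA0w_sat (V := dom M) param (ax_lt01 _)). Qed.

(** [ring] only recognizes operations that are applied constants. *)
Definition madd (a b : N) : N := a + b.
Definition mmul (a b : N) : N := a * b.

Lemma m_semiring : semi_ring_theory (0 : N) 1 madd mmul (@eq N).
Proof.
  constructor; unfold madd, mmul; intros; rewrite ?(addC 0), ?(mulC 1), ?(mulC 0), ?(mulC (_ + _)),
    ?add0, ?mul0, ?mul1, ?mulDr, ?addA, ?mulA; trivial using addC, mulC.
  now rewrite (mulC n), (mulC m).
Qed.

Ltac fold_ops :=
  repeat change (ap (ap (@cplus M) ?a) ?b) with (madd a b);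
  repeat change (ap (ap (@ctimes M) ?a) ?b) with (mmul a b).

Add Ring m_ring : m_semiring (preprocess [fold_ops]).

Lemma zero_or_succ (n : N) : n = 0 \/ exists m, n = m + 1.
Proof.
  revert n. apply m_ind with (A := Or (Var here = 0)%fm
    (Ex tp0 (Var (there here) = Var here + 1)%fm)).
  - intro n. rewrite sat_or, sat_ex. reflexivity.
  - now left.
  - intros n _. right. now exists n.
Qed.

(** Differences are not among the order axioms and come from induction. Through [lt_ex] and [le_ex]
    they turn every later inequality into an equation with an explicit witness, which [ring] can
    check. *)
Lemma compare (a b : N) : (exists c, b = a + c) \/ exists c, a = b + c.
Proof.
  revert b. apply m_ind with (A := Or
    (Ex tp0 (Var (there here) = Var (there (there a)) + Var here)%fm)
    (Ex tp0 (Var (there (there a)) = Var (there here) + Var here)%fm)).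
  - intro n. rewrite sat_or, !sat_ex. reflexivity.
  - right. exists a. ring.
  - intros n [[c ->]|[c ->]].
    + left. exists (c + 1). ring.
    + destruct (zero_or_succ c) as [->|[d ->]].
      * left. exists 1. ring.
      * right. exists d. ring.
Qed.

Lemma lt_addS (a c : N) : a < a + c + 1.
Proof.
  assert (H : 0 < c + 1).
  { assert (K : c < c + 1)
      by (pose proof (lt_add c lt01) as K; rewrite (addC 0), (addC 1), add0 in K; exact K).
    destruct (ge0 c) as [L|<-]; [now apply lt_trans with c|exact K]. }
  apply (lt_add a) in H. replace (0 + a) with a in H by ring.
  now replace (a + c + 1) with (c + 1 + a) by ring.
Qed.

Lemma lt_ex (a b : N) : a < b <-> exists c, b = a + c + 1.
Proof.
  split; [|intros [c ->]; apply lt_addS].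
  intro L. destruct (compare a b) as [[c ->]|[c ->]]; destruct (zero_or_succ c) as [->|[d ->]].
  - rewrite add0 in L. now apply lt_irrefl in L.
  - exists d. ring.
  - rewrite add0 in L. now apply lt_irrefl in L.
  - rewrite addA in L. destruct (@lt_irrefl b). eapply lt_trans; [apply lt_addS|exact L].
Qed.

Lemma le_ex (a b : N) : a <= b <-> exists c, b = a + c.
Proof.
  split.
  - rewrite lt_ex. intros [[c ->]| ->]; [exists (c + 1)|exists 0]; ring.
  - intros [c ->]. destruct (zero_or_succ c) as [->|[d ->]].
    + right. ring.
    + left. rewrite addA. apply lt_addS.
Qed.

Lemma not_lt (a b : N) : ~ a < b <-> b <= a.
Proof.
  destruct (lt_total a b) as [H|[->|H]].
  - split; [easy|]. intros [K| ->] _; [|now apply lt_irrefl in H].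
    destruct (@lt_irrefl a). now apply lt_trans with b.
  - split; [now right|intros _; apply lt_irrefl].
  - split; [now left|]. intros _ K. destruct (@lt_irrefl a). now apply lt_trans with b.
Qed.

Lemma le_trans (a b c : N) : a <= b -> b <= c -> a <= c.
Proof. rewrite !le_ex. intros [d ->] [e ->]. exists (d + e). ring. Qed.

Lemma lt_le_trans (a b c : N) : a < b -> b <= c -> a < c.
Proof. rewrite lt_ex, le_ex, lt_ex. intros [d ->] [e ->]. exists (d + e). ring. Qed.

Lemma le_lt_trans (a b c : N) : a <= b -> b < c -> a < c.
Proof. rewrite le_ex, !lt_ex. intros [d ->] [e ->]. exists (d + e). ring. Qed.

Lemma le_antisym (a b : N) : a <= b -> b <= a -> a = b.
Proof.
  intros [H|H] K; trivial. apply not_lt in K. contradiction.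
Qed.

Lemma lt_succ (a b : N) : a < b + 1 <-> a <= b.
Proof.
  split; intro H.
  - destruct (lt_total a b) as [K|[K|K]]; [now left|now right|].
    apply lt_ex in K as [c ->]. destruct (@lt_irrefl (b + c + 1)).
    eapply lt_le_trans; [exact H|]. apply le_ex. exists c. ring.
  - eapply le_lt_trans; [exact H|]. apply lt_ex. exists 0. ring.
Qed.

Lemma not_lt_0 (a : N) : ~ a < 0.
Proof. apply not_lt, ge0. Qed.

Lemma not_and_lt_le (a b : N) : a < b -> b <= a -> False.
Proof. intros H K. now apply not_lt in K. Qed.


(** ** Truncated subtraction, square roots, pairing *)

Definition mpred (n : N) : N := eval param (tpred (Var n)).
Definition mmonus (a b : N) : N := eval param (monus (Var a) (Var b)).
Definition mpow2 (n : N) : N := eval param (pow2 (Var n)).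
Definition msqrt (n : N) : N := eval param (tsqrt (Var n)).
Definition mpair (i j : N) : N := (i + j) * (i + j) + i.
Definition mfst (z : N) : N := eval param (tfst (Var z)).
Definition msnd (z : N) : N := eval param (tsnd (Var z)).

(** Bracket abstraction under several binders makes terms exponentially large, so
    the arithmetic terms are evaluated by rewriting, never by conversion. *)
Lemma eval_lam2 V W (e : forall s, V s -> dom M s) (e' : forall s, W s -> dom M s)
    r s t (b : tm (ext (ext V r) s) t) (b' : tm (ext (ext W r) s) t) :
  (forall k m, eval (vcons m (vcons k e)) b = eval (vcons m (vcons k e')) b') ->
  eval e (lam (lam b)) = eval e' (lam (lam b')).
Proof.
  intro H. apply ap_ext; intro k. apply ap_ext; intro m. rewrite !eval_lam. apply H.
Qed.

Lemma crec_lam2 V (e : forall s, V s -> dom M s) (b : tm (ext (ext V tp0) tp0) tp0) m n :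
  crec · eval e (lam (lam b)) · m · (n + 1) =
  eval (vcons (crec · eval e (lam (lam b)) · m · n) (vcons n e)) b.
Proof. now rewrite crec_S, !eval_lam. Qed.

Lemma crec_eq (f g : dom M (tp0 ~> tp0 ~> tp0)) (m n : N) :
  f = g -> crec · f · m · n = crec · g · m · n.
Proof. now intros ->. Qed.

Lemma eval_tpred V (e : forall s, V s -> dom M s) t :
  eval e (tpred t) = mpred (eval e t).
Proof.
  unfold mpred, tpred, fn. cbn -[lam]. apply crec_eq. now apply eval_lam2.
Qed.

Lemma mpred_0 : mpred 0 = 0.
Proof. apply crec_0. Qed.

Lemma mpred_S n : mpred (n + 1) = n.
Proof. exact (crec_lam2 param (Var (there here)) 0 n). Qed.

Lemma eval_monus V (e : forall s, V s -> dom M s) s t :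
  eval e (monus s t) = mmonus (eval e s) (eval e t).
Proof.
  unfold mmonus, monus, fn. cbn -[lam tpred]. apply crec_eq. apply eval_lam2.
  intros; now rewrite !eval_tpred.
Qed.

Lemma mmonus_0 a : mmonus a 0 = a.
Proof. apply crec_0. Qed.

Lemma mmonus_S a n : mmonus a (n + 1) = mpred (mmonus a n).
Proof. etransitivity; [exact (crec_lam2 param (tpred (Var here)) a n)|]. now rewrite eval_tpred. Qed.

Lemma eval_pow2 V (e : forall s, V s -> dom M s) t :
  eval e (pow2 t) = mpow2 (eval e t).
Proof.
  unfold mpow2, pow2, fn. cbn -[lam]. apply crec_eq. now apply eval_lam2.
Qed.

Lemma mpow2_0 : mpow2 0 = 1.
Proof. apply crec_0. Qed.

Lemma mpow2_S n : mpow2 (n + 1) = mpow2 n + mpow2 n.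
Proof. exact (crec_lam2 param (Var here + Var here)%tm 1 n). Qed.

Lemma eval_tsqrt V (e : forall s, V s -> dom M s) t :
  eval e (tsqrt t) = msqrt (eval e t).
Proof.
  unfold msqrt, tsqrt, fn. cbn -[lam monus]. apply crec_eq. apply eval_lam2.
  intros. cbn -[monus]. now rewrite !eval_monus.
Qed.

Lemma msqrt_0 : msqrt 0 = 0.
Proof. apply crec_0. Qed.

Lemma msqrt_S n : msqrt (n + 1) =
  msqrt n + mmonus 1 (mmonus ((msqrt n + 1) * (msqrt n + 1)) (n + 1)).
Proof.
  etransitivity; [exact (crec_lam2 param (Var here + monus 1
    (monus ((Var here + 1) * (Var here + 1)) (Var (there here) + 1)))%tm 0 n)|].
  cbn -[monus lam]. now rewrite !eval_monus.
Qed.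

Lemma eval_tfst V (e : forall s, V s -> dom M s) t :
  eval e (tfst t) = mfst (eval e t).
Proof.
  unfold mfst, tfst. rewrite !eval_monus. cbn -[tsqrt]. now rewrite !eval_tsqrt.
Qed.

Lemma eval_tsnd V (e : forall s, V s -> dom M s) t :
  eval e (tsnd t) = msnd (eval e t).
Proof.
  unfold msnd, tsnd. now rewrite !eval_monus, !eval_tsqrt, !eval_tfst.
Qed.

(** The step reads $(b+1)+c$ as $b+(c+1)$, so the induction formula must quantify over $c$. *)
Lemma mmonus_add b c : mmonus (b + c) b = c.
Proof.
  revert c; pattern b; revert b.
  apply m_ind with (A := All tp0
    (monus (Var (there here) + Var here) (Var (there here)) = Var here)%fm).
  - intro n. apply (all_iff (Q := fun c => mmonus (n + c) n = c)); intro c.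
    cbn -[monus]. now rewrite eval_monus.
  - intro c. rewrite mmonus_0. ring.
  - intros n IH c. rewrite mmonus_S.
    replace (n + 1 + c) with (n + (c + 1)) by ring. now rewrite IH, mpred_S.
Qed.

Lemma mmonus_zero a c : mmonus a (a + c) = 0.
Proof.
  revert c. apply m_ind with
    (A := (monus (Var (there a)) (Var (there a) + Var here) = 0)%fm).
  - intro n. cbn -[monus]. now rewrite eval_monus.
  (* Written as $(a+0)-a$, the base case is an instance of [mmonus_add]. *)
  - rewrite <- (add0 a) at 1. rewrite add0. rewrite <- (add0 a) at 1. apply mmonus_add.
  - intros n IH. replace (a + (n + 1)) with (a + n + 1) by ring.
    now rewrite mmonus_S, IH, mpred_0.
Qed.

(** Truth values are numbers: truncated $1-(a-b)$ is 1 if $a\le b$ and 0 otherwise. The increment in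
    [tsqrt] and the case distinctions below have this shape. *)
Definition mleb (a b : N) : N := mmonus 1 (mmonus a b).

Lemma mleb_true a b : a <= b -> mleb a b = 1.
Proof.
  rewrite le_ex. intros [c ->]. unfold mleb. rewrite mmonus_zero. apply mmonus_0.
Qed.

Lemma mleb_false a b : b < a -> mleb a b = 0.
Proof.
  rewrite lt_ex. intros [c ->]. unfold mleb.
  replace (b + c + 1) with (b + (1 + c)) by ring. rewrite mmonus_add. apply mmonus_zero.
Qed.

Lemma mleb_cases a b : a <= b /\ mleb a b = 1 \/ b < a /\ mleb a b = 0.
Proof.
  destruct (classic (b < a)) as [H|H]; [right|left]; split; trivial.
  - now apply mleb_false.
  - now apply not_lt.
  - now apply mleb_true, not_lt.
Qed.

Lemma zero_neq_one : (0 : N) <> 1.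
Proof. intro H. apply (@lt_irrefl 0). rewrite H at 2. apply lt01. Qed.

Lemma mleb_iff a b : mleb a b = 1 <-> a <= b.
Proof.
  destruct (mleb_cases a b) as [[H ->]|[H ->]]; [easy|].
  split; intro K; [now destruct zero_neq_one|]. now apply not_lt in K.
Qed.

Definition meqb (a b : N) : N := mleb a b * mleb b a.

Lemma meqb_true a : meqb a a = 1.
Proof. unfold meqb. rewrite mleb_true; [ring|now right]. Qed.

Lemma meqb_cases a b : a = b /\ meqb a b = 1 \/ a <> b /\ meqb a b = 0.
Proof.
  unfold meqb.
  destruct (mleb_cases a b) as [[H ->]|[H ->]], (mleb_cases b a) as [[K ->]|[K ->]].
  - left. split; [now apply le_antisym|ring].
  - right. split; [intros ->; now apply lt_irrefl in K|ring].
  - right. split; [intros ->; now apply lt_irrefl in H|ring].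
  - destruct (@lt_irrefl a). now apply lt_trans with b.
Qed.

Lemma msqrt_spec n : msqrt n * msqrt n <= n /\ n < (msqrt n + 1) * (msqrt n + 1).
Proof.
  revert n. apply m_ind with
    (A := (tsqrt (Var here) * tsqrt (Var here) <= Var here /\
           Var here < (tsqrt (Var here) + 1) * (tsqrt (Var here) + 1))%fm).
  - intro n. rewrite sat_and, sat_or. cbn -[tsqrt]. now rewrite eval_tsqrt.
  - rewrite msqrt_0. split; [right; ring|]. apply lt_ex. exists 0. ring.
  - intros n [H1 H2]. rewrite msqrt_S.
    (* The increment is the truth value of $(r+1)^2\le n+1$. If it is 1, the new upper bound follows
       from $n+1\le(r+1)^2<(r+2)^2$. *)
    change (mmonus 1 (mmonus ?a ?b)) with (mleb a b).
    destruct (mleb_cases ((msqrt n + 1) * (msqrt n + 1)) (n + 1)) as [[H ->]|[H ->]].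
    + split; trivial. apply lt_succ in H1.
      apply lt_ex in H2 as [c E]. apply lt_ex.
      exists (msqrt n + 1 + msqrt n + 1 + c).
      replace ((msqrt n + 1 + 1) * (msqrt n + 1 + 1)) with
        ((msqrt n + 1) * (msqrt n + 1) + (msqrt n + 1) + (msqrt n + 1) + 1) by ring.
      rewrite E. ring.
    + rewrite add0. split; trivial. apply le_trans with n; trivial. apply le_ex. now exists 1.
Qed.

Lemma sqrt_unique_le (s t n : N) :
  s * s <= n -> n < (t + 1) * (t + 1) -> s <= t.
Proof.
  intros H K. apply not_lt. intro L. apply lt_ex in L as [c ->].
  eapply not_and_lt_le; [exact K|]. eapply le_trans; [|exact H]. apply le_ex.
  exists ((t + 1) * c + c * (t + 1) + c * c). ring.
Qed.

(** As $i\le i+j$, the code $(i+j)^2+i$ lies below $(i+j+1)^2$, so its root is $i+j$; subtraction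
    then recovers $i$ and $j$. *)
Lemma msqrt_mpair i j : msqrt (mpair i j) = i + j.
Proof.
  destruct (msqrt_spec (mpair i j)) as [H K].
  apply le_antisym; eapply sqrt_unique_le; try eassumption; unfold mpair.
  - apply lt_ex. exists (i + j + j). ring.
  - apply le_ex. now exists i.
Qed.

Lemma mfst_mpair i j : mfst (mpair i j) = i.
Proof.
  unfold mfst, tfst. rewrite eval_monus. cbn -[tsqrt mpair]. rewrite !eval_tsqrt.
  cbn -[msqrt mpair mmonus]. unfold param. rewrite msqrt_mpair. apply mmonus_add.
Qed.

Lemma msnd_mpair i j : msnd (mpair i j) = j.
Proof.
  unfold msnd, tsnd. rewrite eval_monus, eval_tsqrt, eval_tfst.
  cbn -[msqrt mpair mmonus mfst]. unfold param.
  rewrite msqrt_mpair, mfst_mpair. apply mmonus_add.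
Qed.

Lemma mpow2_gt n : n < mpow2 n.
Proof.
  revert n. apply m_ind with (A := (Var here < pow2 (Var here))%fm).
  - intro n. cbn -[pow2]. now rewrite eval_pow2.
  - rewrite mpow2_0. apply lt01.
  - intros n H. rewrite mpow2_S. apply lt_ex in H as [c ->]. apply lt_ex.
    exists (n + c + c). ring.
Qed.

(** ** Rational and real numbers *)

Record mfrac := MFrac { mpos : N; mneg : N; mden : N }.

Definition evalf V (e : forall s, V s -> dom M s) (x : frac V) : mfrac :=
  MFrac (eval e (fpos x)) (eval e (fneg x)) (eval e (fden x)).

Definition mfopp (x : mfrac) : mfrac := MFrac (mneg x) (mpos x) (mden x).
Definition mfadd (x y : mfrac) : mfrac :=
  MFrac (mpos x * mden y + mpos y * mden x)
        (mneg x * mden y + mneg y * mden x)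
        (mden x * mden y).
Definition mfsub (x y : mfrac) : mfrac := mfadd x (mfopp y).
Definition mflt (x y : mfrac) : Prop :=
  mpos x * mden y + mneg y * mden x < mpos y * mden x + mneg x * mden y.
Definition mfle (x y : mfrac) : Prop :=
  mpos x * mden y + mneg y * mden x <= mpos y * mden x + mneg x * mden y.
Definition mfabs_lt (x y : mfrac) : Prop := mflt x y /\ mflt (mfopp x) y.
Definition mrat (q : N) : mfrac := MFrac (mfst q) (mfst (msnd q)) (msnd (msnd q) + 1).
Definition mfpow2 (n : N) : mfrac := MFrac 1 0 (mpow2 n).
Definition mfpow2' (n : N) : mfrac := MFrac (1 + 1) 0 (mpow2 n).

Definition Mreal (x : dom M tp1) : Prop := forall n i,
  mfabs_lt (mfsub (mrat (x · n)) (mrat (x · (n + i)))) (mfpow2 n).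
Definition Mle (x y : dom M tp1) : Prop := forall n,
  mfle (mrat (x · n)) (mfadd (mrat (y · n)) (mfpow2' n)).
Definition Mlt (x y : dom M tp1) : Prop := exists n,
  mflt (mfadd (mrat (x · n)) (mfpow2' n)) (mrat (y · n)).
Definition Mdist_lt (x y e : dom M tp1) : Prop := exists n,
  mfabs_lt (mfsub (mrat (x · (n + 1))) (mrat (y · (n + 1))))
           (mfsub (mrat (e · n)) (mfpow2' n)).
Definition mconst (q : N) : dom M tp1 := cpi · q.
Definition mcode (a b c : N) : N := mpair a (mpair b c).
Definition Munit (x : dom M tp1) : Prop :=
  Mreal x /\ Mle (mconst 0) x /\ Mle x (mconst (mcode 1 0 0)).

Lemma sat_fex V (e : forall s, V s -> dom M s) s b :
  sat e (fex s b) <-> exists m, sat (vcons m e) (b (Var here)).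
Proof. apply sat_ex. Qed.

Lemma sat_fabs_lt V (e : forall s, V s -> dom M s) x y :
  sat e (fabs_lt x y) <-> mfabs_lt (evalf e x) (evalf e y).
Proof. apply sat_and. Qed.

Lemma sat_fle V (e : forall s, V s -> dom M s) x y :
  sat e (fle x y) <-> mfle (evalf e x) (evalf e y).
Proof. apply sat_or. Qed.

Lemma evalf_rat V (e : forall s, V s -> dom M s) q : evalf e (rat q) = mrat (eval e q).
Proof. unfold evalf, mrat. cbn [rat fpos fneg fden eval].
  now rewrite !eval_tfst, !eval_tsnd. Qed.

Lemma evalf_fpow2 V (e : forall s, V s -> dom M s) n :
  evalf e (fpow2 n) = mfpow2 (eval e n).
Proof. unfold evalf, mfpow2. cbn [fpow2 fpos fneg fden eval]. now rewrite eval_pow2. Qed.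

Lemma evalf_fpow2' V (e : forall s, V s -> dom M s) n :
  evalf e (fpow2' n) = mfpow2' (eval e n).
Proof. unfold evalf, mfpow2'. cbn [fpow2' fpos fneg fden eval]. now rewrite eval_pow2. Qed.

Lemma sat_is_real V (e : forall s, V s -> dom M s) x :
  sat e (is_real x) <-> Mreal (eval e x).
Proof.
  apply all_iff; intro n. apply all_iff; intro i. rewrite sat_fabs_lt.
  change (evalf ?e (fsub ?a ?b)) with (mfsub (evalf e a) (evalf e b)).
  rewrite !evalf_rat, ?evalf_fpow2, ?evalf_fpow2'.
  cbn [eval vcons shift tren]. rewrite !eval_shift. reflexivity.
Qed.

Lemma sat_real_le V (e : forall s, V s -> dom M s) x y :
  sat e (real_le x y) <-> Mle (eval e x) (eval e y).
Proof.
  apply all_iff; intro n. rewrite sat_fle.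
  change (evalf ?e (fadd ?a ?b)) with (mfadd (evalf e a) (evalf e b)).
  rewrite !evalf_rat, ?evalf_fpow2, ?evalf_fpow2'.
  cbn [eval vcons shift tren]. rewrite !eval_shift. reflexivity.
Qed.

Lemma sat_real_lt V (e : forall s, V s -> dom M s) x y :
  sat e (real_lt x y) <-> Mlt (eval e x) (eval e y).
Proof.
  unfold real_lt. rewrite sat_fex. apply ex_iff; intro n.
  change (sat ?e (flt ?a ?b)) with (mflt (evalf e a) (evalf e b)).
  change (evalf ?e (fadd ?a ?b)) with (mfadd (evalf e a) (evalf e b)).
  rewrite !evalf_rat, ?evalf_fpow2, ?evalf_fpow2'.
  cbn [eval vcons shift tren]. rewrite !eval_shift. reflexivity.
Qed.

Lemma sat_real_dist_lt V (e : forall s, V s -> dom M s) x y z :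
  sat e (real_dist_lt x y z) <-> Mdist_lt (eval e x) (eval e y) (eval e z).
Proof.
  unfold real_dist_lt. rewrite sat_fex. apply ex_iff; intro n. rewrite sat_fabs_lt.
  change (evalf ?e (fsub ?a ?b)) with (mfsub (evalf e a) (evalf e b)).
  rewrite !evalf_rat, ?evalf_fpow2, ?evalf_fpow2'.
  cbn [eval vcons shift tren]. rewrite !eval_shift. reflexivity.
Qed.

Lemma sat_in_unit_interval V (e : forall s, V s -> dom M s) x :
  sat e (in_unit_interval x) <-> Munit (eval e x).
Proof.
  unfold in_unit_interval. rewrite !sat_and, sat_is_real, !sat_real_le. reflexivity.
Qed.

(** ** The net of finite choice sequences *)

Lemma sat_seq_converges V (e : forall s, V s -> dom M s) x y :
  sat e (seq_converges x y) <-> forall eps, Mreal eps -> Mlt (mconst 0) eps ->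
    exists m, forall n, m <= n -> Mdist_lt (eval e x · n) (eval e y) eps.
Proof.
  apply all_iff; intro eps. cbn [sat]. rewrite sat_is_real, sat_real_lt, sat_fex.
  do 2 apply imp_iff. apply ex_iff; intro m. apply all_iff; intro n. cbn [sat].
  rewrite sat_or, sat_real_dist_lt. cbn [sat eval vcons shift tren].
  rewrite !eval_shift. reflexivity.
Qed.

(** Transitivity, reflexivity, monotonicity and values in the unit interval are asked for on the
    whole Baire space, since the net built below has them everywhere. *)
Lemma SUB0_sem V (e : forall s, V s -> dom M s) : sat e SUB0 ->
  forall (D : dom M tp2) (R : dom M (tp1 ~> tp1 ~> tp0)) (x : dom M (tp1 ~> tp1))
    (y : dom M tp1),
  (forall f, D · f <= 1) ->
  (forall f g, R · f · g <= 1) ->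
  (exists f, D · f = 1) ->
  (forall f g h, R · f · g = 1 -> R · g · h = 1 -> R · f · h = 1) ->
  (forall f, R · f · f = 1) ->
  (forall f g, D · f = 1 -> D · g = 1 ->
    exists h, D · h = 1 /\ R · f · h = 1 /\ R · g · h = 1) ->
  (forall d, Munit (x · d)) ->
  (forall f g, R · f · g = 1 -> Mle (x · f) (x · g)) ->
  Munit y ->
  (forall eps, Mreal eps -> Mlt (mconst 0) eps -> exists d, D · d = 1 /\
    forall f, D · f = 1 -> R · d · f = 1 -> Mdist_lt (x · f) y eps) ->
  exists Phi : dom M (tp0 ~> tp1), (forall n, D · (Phi · n) = 1) /\
    forall eps, Mreal eps -> Mlt (mconst 0) eps -> exists m, forall n, m <= n ->
      Mdist_lt (x · (Phi · n)) y eps.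
Proof.
  intros HS D R x y HD HR Hne Htr Hrf Hdir Hunit Hinc Hy Hconv.
  (* The conclusion of [SUB0] with explicit indices: under the innermost binder the context is the
     bound number, [Phi], then [y], [x], [R], [D]. *)
  assert (HP : sat (vcons y (vcons x (vcons R (vcons D e))))
    (fex (tp0 ~> tp1) (fun Phi =>
    fall tp0 (fun n => mem (Var (there (there (there (there (there here)))))) (shift _ Phi · n)%tm)
    /\ seq_increasing (fn tp0 (fun n => Var (there (there (there here))) · (shift _ Phi · n))%tm)
    /\ seq_converges (fn tp0 (fun n => Var (there (there (there here))) · (shift _ Phi · n))%tm)
         (Var (there here))))%fm).
  { refine (HS D R x y _ _ _ _ _ _ _).
    - intro f. apply sat_or, HD.
    - intros f g. apply sat_or, HR.
    - unfold directed. rewrite !sat_and. repeat split.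
      + apply sat_fex, Hne.
      + intros f _ g _ h _. exact (Htr f g h).
      + intros f _. exact (Hrf f).
      + intros f Hf g Hg. destruct (Hdir f g Hf Hg) as (h & A & B & C).
        apply sat_fex. exists h. apply sat_and; split; [exact A|]. apply sat_and; split; [exact B|exact C].
    - intros d _. apply sat_in_unit_interval, Hunit.
    - intros f _ g _ Hfg. apply sat_real_le, Hinc, Hfg.
    - apply sat_in_unit_interval, Hy.
    - intros eps E P. apply sat_is_real in E. apply sat_real_lt in P.
      destruct (Hconv eps E P) as (d & A & B). apply sat_fex. exists d.
      apply sat_and; split; [exact A|]. intros f Hf Hdf.
      apply sat_real_dist_lt, B; [exact Hf|exact Hdf]. }
  apply sat_fex in HP as [Phi HP]. rewrite !sat_and in HP. destruct HP as (H1 & _ & H2).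
  exists Phi. split; [exact H1|]. intros eps E P.
  rewrite sat_seq_converges in H2. destruct (H2 eps E P) as [m K]. exists m. intros n L.
  specialize (K n L). rewrite eval_fn in K. exact K.
Qed.

Lemma mrat_mcode a b c : mrat (mcode a b c) = MFrac a b (c + 1).
Proof. unfold mrat, mcode. now rewrite !msnd_mpair, !mfst_mpair. Qed.

Lemma mrat_mconst a b c n : mrat (mconst (mcode a b c) · n) = MFrac a b (c + 1).
Proof. unfold mconst. now rewrite cpi_ap, mrat_mcode. Qed.

Lemma mconst_0 : mconst 0 = mconst (mcode 0 0 0).
Proof. f_equal. unfold mcode, mpair. ring. Qed.

Lemma Mreal_mconst a b c : Mreal (mconst (mcode a b c)).
Proof.
  intros n i. rewrite !mrat_mconst. unfold mfabs_lt, mflt; simpl.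
  set (P := mpow2 n). split; apply lt_ex; exists (c * c + c + c); ring.
Qed.

Lemma Mle_mconst a a' c c' k : a' * (c + 1) = a * (c' + 1) + k ->
  Mle (mconst (mcode a 0 c)) (mconst (mcode a' 0 c')).
Proof.
  intros E n. rewrite !mrat_mconst. unfold mfle; simpl.
  set (P := mpow2 n). apply le_ex. exists (k * P + (1 + 1) * (c' + 1) * (c + 1)).
  transitivity ((a' * (c + 1)) * P + (1 + 1) * (c' + 1) * (c + 1)); [ring|].
  rewrite E. ring.
Qed.

Lemma Munit_mconst a c k : c + 1 = a + k -> Munit (mconst (mcode a 0 c)).
Proof.
  intro E. split; [|split].
  - apply Mreal_mconst.
  - rewrite mconst_0. apply Mle_mconst with a. ring.
  - apply Mle_mconst with k. transitivity (c + 1); [ring|]. rewrite E. ring.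
Qed.

(** The real number [l / (l + 1)]. *)
Definition approx (l : N) : dom M tp1 := mconst (mcode l 0 l).
Definition mone : dom M tp1 := mconst (mcode 1 0 0).

(** If $2^{-n+1}<\varepsilon_n=(p-q)/(d+1)$, the gap is a positive fraction with denominator
    $(d+1)2^n$, hence at least $1/((d+1)2^n)$. The distance $1/(l+1)$ is smaller once
    $l\ge(d+1)2^n$. *)
Lemma approx_converges eps : Mlt (mconst 0) eps ->
  exists L, forall l, L <= l -> Mdist_lt (approx l) mone eps.
Proof.
  rewrite mconst_0. intros [n H]. rewrite mrat_mconst in H.
  exists ((msnd (msnd (eps · n)) + 1) * mpow2 n). intros l Ll. exists n.
  unfold approx, mone. rewrite !mrat_mconst.
  unfold mfabs_lt, mflt, mrat in *; simpl in *.
  set (p := mfst (eps · n)) in *. set (q := mfst (msnd (eps · n))) in *.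
  set (d := msnd (msnd (eps · n))) in *. set (P := mpow2 n) in *. clearbody p q d P.
  apply lt_ex in H as [r H]. apply le_ex in Ll as [c Ll].
  assert (E : p * P = (1 + 1) * (d + 1) + q * P + r + 1).
  { transitivity (p * ((0 + 1) * P) + (0 * P + 0 * (0 + 1)) * (d + 1)); [ring|].
    rewrite H. ring. }
  split; apply lt_ex.
  - exists (r * (l + 1) + l + (d + 1) * P).
    transitivity ((p * P) * (l + 1) + (l + 1) * (d + 1) * P); [ring|].
    rewrite E. ring.
  - exists (r * (l + 1) + c).
    transitivity ((p * P) * (l + 1) + l * (d + 1) * P); [ring|].
    rewrite E. rewrite Ll. ring.
Qed.

Lemma Mlt_inv K : Mlt (mconst 0) (mconst (mcode 1 0 K)).
Proof.
  (* The index $n=2(K+1)$ works because $2(K+1)<2^n$, that is, $2^{-n+1}<1/(K+1)$. *)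
  rewrite mconst_0. exists ((1 + 1) * (K + 1)). rewrite !mrat_mconst.
  pose proof (mpow2_gt ((1 + 1) * (K + 1))) as H.
  unfold mflt; simpl. set (P := mpow2 _) in *. clearbody P.
  apply lt_ex in H as [c ->]. apply lt_ex. exists c. ring.
Qed.

Lemma approx_close K l : Mdist_lt (approx l) mone (mconst (mcode 1 0 K)) -> K < l.
Proof.
  (* The retained half of the absolute value is $1-l/(l+1)<1/(K+1)-2^{-n+1}$, and its left side
     equals $1/(l+1)$. *)
  intros [n [_ H]]. unfold approx, mone in H. rewrite !mrat_mconst in H.
  unfold mflt in H; simpl in H. apply NNPP. rewrite not_lt, le_ex. intros [c ->].
  set (P := mpow2 n) in *. clearbody P.
  eapply not_and_lt_le; [exact H|]. apply le_ex.
  exists (c * P + (1 + 1) * (l + c + 1) * (l + 1)). ring.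
Qed.

(** * Choice sequences for a total 0-1-valued functional *)

Section Net.

Variable a : dom M (tp0 ~> tp1 ~> tp0).
Hypothesis a_bin : forall n f, a · n · f = 0 \/ a · n · f = 1.
Hypothesis a_total : forall n, exists f, a · n · f = 1.

(** [w] codes the sequence of length [w 0] with [i]-th entry [w (i + 1, _)]. *)
Definition entry : dom M (tp1 ~> tp0 ~> tp1) := eval param
  (fn tp1 (fun w => fn tp0 (fun i => fn tp0 (fun j =>
    ↑↑w · tpair (↑i + 1) j))))%tm.

Lemma entry_ap w i j : entry · w · i · j = w · mpair (i + 1) j.
Proof. unfold entry. now rewrite !eval_fn. Qed.

(** The product of the truth values $a(i,w_i)$ for $i<n$: a bounded universal quantifier computed by
    the recursor, so that the index set has a characteristic function given by a term. *)
Definition check : dom M (tp1 ~> tp0 ~> tp0) := eval param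
  (fn tp1 (fun w => Rec · lam (lam
    (Var here * (Var (there (there (there a))) · Var (there here)
      · (Var (there (there (there entry))) · Var (there (there here)) · Var (there here)))))
    · 1))%tm.

Lemma check_0 w : check · w · 0 = 1.
Proof. unfold check. rewrite eval_fn. apply crec_0. Qed.

Lemma check_S w n : check · w · (n + 1) = check · w · n * (a · n · (entry · w · n)).
Proof. unfold check. rewrite eval_fn. apply crec_lam2. Qed.

Lemma check_bin w n : check · w · n = 0 \/ check · w · n = 1.
Proof.
  pattern n; revert n. apply m_ind with
    (A := (Var (there check) · Var (there w) · Var here = 0
           \/ Var (there check) · Var (there w) · Var here = 1)%fm).
  - intro n. rewrite sat_or. reflexivity.
  - right. apply check_0.
  - intros n [H|H]; rewrite check_S, H; [left; ring|].
    destruct (a_bin n (entry · w · n)) as [->| ->]; [left|right]; ring.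
Qed.

Lemma check_iff w n :
  check · w · n = 1 <-> forall i, i < n -> a · i · (entry · w · i) = 1.
Proof.
  pattern n; revert n. apply m_ind with
    (A := (let p := Var (there check) · Var (there w) · Var here = 1 in
      let q := All tp0 (Var here < Var (there here)
        ==> Var (there (there a)) · Var here
          · (Var (there (there entry)) · Var (there (there w)) · Var here) = 1) in
      (p ==> q) /\ (q ==> p))%fm).
  - intro n. cbv zeta. rewrite sat_and. reflexivity.
  - split; [|intros _; apply check_0]. intros _ i L. now apply not_lt_0 in L.
  - intros n IH. rewrite check_S. split.
    + intros H i L. apply lt_succ in L.
      destruct (check_bin w n) as [E|E]; rewrite E in H.
      { destruct zero_neq_one. rewrite <- H. ring. }
      destruct L as [L| ->]; [now apply IH|]. rewrite <- H. ring.
    + intro H. rewrite H by (apply lt_succ; now right).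
      replace (check · w · n) with (1 : N); [ring|]. symmetry. apply IH.
      intros i L. apply H, lt_succ. now left.
Qed.

(** A case distinction in arithmetic on the position $(i,j)$: for $i=0$ the value is the new length
    $n+1$ (position 0 codes $(0,0)$), for $i=n+1$ it is $f(j)$, the new last entry, and otherwise
    [w] is kept. Here [l] is the truth value of $i=0$ and [h * h'] that of $i=n+1$. *)
Definition extend (w : dom M tp1) (n : N) (f : dom M tp1) : dom M tp1 := eval param
  (fn tp0 (fun p =>
    let l := monus 1 (tfst p) in
    let h := monus 1 (monus (tfst p) (↑(Var n) + 1)) in
    let h' := monus 1 (monus (↑(Var n) + 1) (tfst p)) in
    l * (↑(Var n) + 1)
    + monus 1 l * (h * h' * (↑(Var f) · tsnd p) + monus 1 (h * h') * (↑(Var w) · p))))%tm.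

Lemma extend_ap w n f i j : extend w n f · mpair i j =
  mmonus 1 i * (n + 1) + mmonus 1 (mmonus 1 i) *
    (meqb i (n + 1) * (f · j) + mmonus 1 (meqb i (n + 1)) * (w · mpair i j)).
Proof.
  unfold extend. rewrite eval_fn. cbv zeta. cbn [eval vcons shift tren].
  rewrite !eval_monus. cbn [eval vcons shift tren]. rewrite !eval_monus.
  cbn [eval vcons shift tren]. rewrite !eval_tfst, !eval_tsnd.
  cbn [eval vcons shift tren]. unfold param. now rewrite mfst_mpair, msnd_mpair.
Qed.

Lemma mmonus_self b : mmonus b b = 0.
Proof. rewrite <- (add0 b) at 2. apply mmonus_zero. Qed.

Lemma mmonus_1_S n : mmonus 1 (n + 1) = 0.
Proof. rewrite addC. apply mmonus_zero. Qed.

Lemma extend_length w n f : extend w n f · 0 = n + 1.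
Proof.
  replace (0 : N) with (mpair 0 0) at 1 by (unfold mpair; ring).
  rewrite extend_ap, mmonus_0, mmonus_self. ring.
Qed.

Lemma extend_last w n f : entry · extend w n f · n = f.
Proof.
  apply ap_ext; intro j. rewrite entry_ap, extend_ap, mmonus_1_S, mmonus_0, meqb_true,
    mmonus_self. ring.
Qed.

Lemma extend_entry w n f i : i < n -> entry · extend w n f · i = entry · w · i.
Proof.
  intro L. apply ap_ext; intro j.
  rewrite !entry_ap, extend_ap, mmonus_1_S, mmonus_0.
  destruct (meqb_cases (i + 1) (n + 1)) as [[E _]|[_ ->]].
  - apply (lt_add 1) in L. rewrite E in L. now apply lt_irrefl in L.
  - rewrite mmonus_0. ring.
Qed.

Lemma choice_seq_ex n : exists w : dom M tp1, w · 0 = n /\ check · w · n = 1.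
Proof.
  pattern n; revert n. apply m_ind with
    (A := Ex tp1 (Var here · 0 = Var (there here)
        /\ Var (there (there check)) · Var here · Var (there here) = 1)%fm).
  - intro n. rewrite sat_ex. apply ex_iff; intro w. rewrite sat_and. reflexivity.
  (* The zero function codes the empty sequence, whose check is the empty product. *)
  - exists (cpi · 0). split; [apply cpi_ap|apply check_0].
  - intros n (w & E & H). destruct (a_total n) as [f F]. exists (extend w n f).
    split; [apply extend_length|]. apply check_iff. intros i L.
    apply lt_succ in L as [L| ->].
    + rewrite extend_entry by trivial. revert i L. now apply check_iff.
    + now rewrite extend_last.
Qed.

Definition index_set : dom M tp2 := eval param
  (fn tp1 (fun w => ↑(Var check) · w · (w · 0)))%tm.
Definition index_rel : dom M (tp1 ~> tp1 ~> tp0) := eval param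
  (fn tp1 (fun v => fn tp1 (fun w => monus 1 (monus (↑v · 0) (w · 0)))))%tm.
Definition net : dom M (tp1 ~> tp1) := eval param
  (fn tp1 (fun w => real_of_rat (rat_code (w · 0) 0 (w · 0))))%tm.

Lemma index_set_ap w : index_set · w = check · w · (w · 0).
Proof. unfold index_set. now rewrite eval_fn. Qed.

Lemma index_rel_ap v w : index_rel · v · w = mleb (v · 0) (w · 0).
Proof.
  unfold index_rel. rewrite !eval_fn, !eval_monus. reflexivity.
Qed.

Lemma net_ap w : net · w = approx (w · 0).
Proof. unfold net. now rewrite eval_fn. Qed.

Lemma SUB0_choice V (e : forall s, V s -> dom M s) : sat e SUB0 ->
  exists Y : dom M (tp0 ~> tp1), forall n, a · n · (Y · n) = 1.
Proof.
  intro HS.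
  destruct (@SUB0_sem V e HS index_set index_rel net mone) as (Phi & PhiD & PhiC).
  - intro w. rewrite index_set_ap.
    destruct (check_bin w (w · 0)) as [->| ->]; [left; apply lt01|now right].
  - intros v w. rewrite index_rel_ap.
    destruct (mleb_cases (v · 0) (w · 0)) as [[_ ->]|[_ ->]]; [now right|left; apply lt01].
  - destruct (choice_seq_ex 0) as (w & E & H). exists w. now rewrite index_set_ap, E.
  - intros u v w. rewrite !index_rel_ap, !mleb_iff. apply le_trans.
  - intro w. rewrite index_rel_ap, mleb_iff. now right.
  - intros v w Hv Hw.
    assert (K : v · 0 <= w · 0 \/ w · 0 <= v · 0).
    { destruct (lt_total (v · 0) (w · 0)) as [H|[H|H]]; auto. }
    destruct K as [K|K]; [exists w|exists v]; split; trivial;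
      rewrite !index_rel_ap, !mleb_iff; auto.
  - intro w. rewrite net_ap. apply Munit_mconst with 1. ring.
  - intros v w. rewrite index_rel_ap, mleb_iff, le_ex, !net_ap. intros [c ->].
    apply Mle_mconst with c. ring.
  - apply Munit_mconst with 0. ring.
  - intros eps _ P. destruct (approx_converges P) as [L HL].
    destruct (choice_seq_ex L) as (w & E & H). exists w.
    rewrite index_set_ap, E. split; trivial. intros v _.
    rewrite index_rel_ap, mleb_iff, E, net_ap. apply HL.
  - assert (G : forall k, exists n, k < Phi · n · 0).
    (* The tolerance $1/(k+1)$ turns closeness to 1 into a length above $k$. *)
    { intro k. destruct (PhiC _ (Mreal_mconst 1 0 k) (Mlt_inv k)) as [m H].
      exists m. apply approx_close. rewrite <- net_ap. apply H. now right. }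
    assert (G' : exists g : dom M tp2, forall f, f · 0 < Phi · (g · f) · 0).
    (* The choice axiom ranges over type 1 objects $f$, of which only $f(0)$ is used; [Phi] is a
       parameter of the quantifier-free formula. *)
    { pose (B := (Var (there here) · 0
        < Var (there (there Phi)) · Var here · 0 : fm (ext (ext (dom M) tp1) tp0))%fm).
      assert (HB : qf B) by exact I.
      pose proof (RCA0w_sat param (ax_QFAC10 HB)) as H.
      apply sat_ex in H as [g H].
      - exists g. exact H.
      - intro f. apply sat_ex. exact (G (f · 0)). }
    destruct G' as [g G'].
    (* The number $k$ enters [g] as the constant function [Pi · k]. The sequence obtained has length
       above $k$, so membership in the index set makes its entry $k$ correct. *)
    exists (eval param (fn tp0 (fun k => ↑(Var entry) · (↑(Var Phi) · (↑(Var g) · (Pi · k)))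
      · k))%tm).
    intro k. rewrite eval_fn. simpl. unfold param.
    specialize (PhiD (g · (cpi · k))). specialize (G' (cpi · k)).
    rewrite cpi_ap in G'. rewrite index_set_ap in PhiD.
    revert k G' PhiD. intros k L H. exact (proj1 (check_iff _ _) H k L).
Qed.

End Net.

(** ** Quantifier-free formulas have characteristic terms *)

(** Built from truth values: $s<t$ is $s+1\le t$, and an implication becomes $1-t(1-u)$, which is 0
    only for $t=1$, $u=0$. One term serves all environments, so it can be abstracted to a
    functional. *)
Lemma qf_char V (p : fm V) : qf p -> exists t : tm V tp0, forall e : forall s, V s -> dom M s,
  (eval e t = 0 \/ eval e t = 1) /\ (eval e t = 1 <-> sat e p).
Proof.
  induction p as [V|V s t|V s t|V p IHp q IHq|V s p IHp]; simpl; intro Q.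
  - exists 0%tm. intro e. split; [now left|]. split; [apply zero_neq_one|easy].
  - exists (monus 1 (monus s t) * monus 1 (monus t s))%tm. intro e. cbn [eval sat].
    rewrite !eval_monus. change (mmonus _ (mmonus ?a ?b)) with (mleb a b).
    change (mleb ?a ?b * mleb ?b ?a) with (meqb a b).
    destruct (meqb_cases (eval e s) (eval e t)) as [[H ->]|[H ->]].
    + split; [now right|easy].
    + split; [now left|]. split; [|easy]. intro. now destruct zero_neq_one.
  - exists (monus 1 (monus (s + 1) t))%tm. intro e.
    rewrite !eval_monus. change (mmonus _ (mmonus ?a ?b)) with (mleb a b).
    cbn [eval].
    assert (E : eval e s + 1 <= eval e t <-> clt (eval e s) (eval e t)).
    { rewrite le_ex, lt_ex. split; intros [c C]; exists c; rewrite C; ring. }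
    split; [|rewrite mleb_iff; exact E].
    destruct (mleb_cases (eval e s + 1) (eval e t)) as [[_ ->]|[_ ->]]; auto.
  - destruct Q as [Qp Qq], (IHp Qp) as [t T], (IHq Qq) as [u U].
    exists (monus 1 (t * monus 1 u))%tm. intro e.
    destruct (T e) as [T0 T1], (U e) as [U0 U1]. rewrite <- T1, <- U1.
    rewrite eval_monus. cbn [eval]. rewrite eval_monus. cbn [eval].
    destruct T0 as [->| ->], U0 as [->| ->];
      rewrite ?mmonus_0, ?mmonus_self, ?mul0, ?(mulC 0), ?mul0, ?mul1, ?mmonus_0, ?mmonus_self;
      intuition (try easy; try (now destruct zero_neq_one)).
  - easy.
Qed.

Lemma SUB0_QFAC V (e : forall s, V s -> dom M s) (A : fm (ext (ext V tp0) tp1)) :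
  qf A -> sat e SUB0 -> sat e (QFAC A).
Proof.
  intros Q HS HA. destruct (qf_char Q) as [t Ht].
  (* Abstracting the two distinguished variables and evaluating the remaining parameters in [e]
     gives the characteristic functional. *)
  destruct (@SUB0_choice (eval e (lam (lam t)))) with (e := e) as [Y HY]; trivial.
  - intros n f. rewrite !eval_lam. apply Ht.
  - intro n. specialize (HA n). apply sat_ex in HA as [f F].
    exists f. rewrite !eval_lam. now apply Ht.
  - apply sat_ex. exists Y. intro n. specialize (HY n). rewrite !eval_lam in HY.
    apply Ht in HY. apply sat_subst.
    match goal with |- sat ?h A => replace h with (vcons (Y · n) (vcons n e)) end; trivial.
    apply sub_ext; intros s v. destruct v as [|s v]; [|destruct v]; reflexivity.
Qed.

End Model.

Theorem theorem4p5 (A : fm (ext (ext vars tp0) tp1)) (hA : qf A) :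
  prv RCA0w_IND [] (Imp SUB0 (QFAC A)).
Proof.
  apply completeness. intros M HM e. exact (SUB0_QFAC HM hA).
Qed.
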